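(* Let $p\ge 1$ and $n_1\le n_2\le\cdots\le n_p$ be positive integers with $n_1\cdots n_{p-1}\le n_p$, let $N=n_1\cdots n_p$, and let $k$ be a positive integer. Then: (a) $\Sigma^k(n_1,\ldots,n_p)$ is a connected, compact subset of $\Sigma(n_1,\ldots,n_p)$. In particular, if $\Sigma^k(n_1,\ldots,n_p)\neq\Sigma(n_1,\ldots,n_p)$, then $\Sigma^k(n_1,\ldots,n_p)$ is not dense in $\Sigma(n_1,\ldots,n_p)$ and its complement in $\Sigma(n_1,\ldots,n_p)$ is (relatively) open. (b) If $k<n_1^2\cdots n_{p-1}^2$, then $\Sigma^k(n_1,\ldots,n_p)$ has measure $0$ in $\Sigma(n_1,\ldots,n_p)$. (c) If $k\ge n_1^2\cdots n_{p-1}^2$, then $\Sigma^k(n_1,\ldots,n_p)$ has positive measure in $\Sigma(n_1,\ldots,n_p)$, and in fact contains a nonempty open subset.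
   Context: For a positive integer $w$, a density matrix on $\mathbb{C}^w$ is a $w\times w$ complex Hermitian positive semi-definite matrix of trace $1$; let $\mathcal{DM}(w)$ denote the set of these. Let $N=n_1\cdots n_p$ and identify $\mathbb{C}^N=\mathbb{C}^{n_1}\otimes\cdots\otimes\mathbb{C}^{n_p}$. A product density matrix is one of the form $A_1\otimes\cdots\otimes A_p$ with $A_i\in\mathcal{DM}(n_i)$. $\Sigma(n_1,\ldots,n_p)\subset\mathcal{DM}(N)$ is the set of separable density matrices, i.e. convex combinations of (finitely many) product density matrices. $\Sigma^k(n_1,\ldots,n_p)$ is the set of $A\in\Sigma(n_1,\ldots,n_p)$ that can be written as a convex combination of at most $k$ product density matrices (i.e. whose optimal ensemble length is $k$ or fewer). Measure is $(N^2-1)$-dimensional Lebesgue measure on the real affine hyperplane $\tau_1(N)$ of $N\times N$ complex Hermitian matrices of trace $1$ (which contains $\Sigma(n_1,\ldots,n_p)$); ''open'' means open in $\tau_1(N)$ (resp. relatively open in $\Sigma(n_1,\ldots,n_p)$ where stated). *)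

(* Defs.v *)
From HB Require Import structures.
From mathcomp Require Import all_boot all_order all_algebra.
From mathcomp Require Import all_classical all_reals all_analysis.
From mathcomp.real_closed Require Import complex.
Import numFieldNormedType.Exports.
Import Order.TTheory GRing.Theory Num.Theory.

Set Implicit Arguments.
Unset Strict Implicit.
Unset Printing Implicit Defensive.

Local Open Scope ring_scope.
Local Open Scope classical_set_scope.

Section Defs.
Variable R : realType.
Local Notation C := R[i].

Definition mxadj (m n : nat) (A : 'M[C]_(m, n)) : 'M[C]_(n, m) :=
  (map_mx Num.conj A)^T.

Definition hermitian (N : nat) (A : 'M[C]_N) : Prop := mxadj A = A.

Definition hpsd (N : nat) (A : 'M[C]_N) : Prop :=
  hermitian A /\ forall v : 'cV[C]_N, 0 <= (mxadj v *m A *m v) 0 0.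

Definition density_matrix (N : nat) (A : 'M[C]_N) : Prop :=
  hpsd A /\ \tr A = 1.

Definition tdim (p : nat) (n : 'I_p -> nat) : nat := \prod_(m < p) n m.

(** digit m of the index r in the mixed radix (n_1,...,n_p), first factor most
    significant: this is the standard identification
    C^N = C^{n_1} (x) ... (x) C^{n_p} (Kronecker ordering). *)
Definition digit (p : nat) (n : 'I_p -> nat) (r : nat) (m : 'I_p) : nat :=
  (r %/ \prod_(j < p | (m < j)%N) n j) %% n m.

Definition mxentry (d : nat) (A : 'M[C]_d) (i j : nat) : C :=
  match (insub i : option 'I_d), (insub j : option 'I_d) with
  | Some i', Some j' => A i' j'
  | _, _ => 0
  end.

Definition prod_mx (p : nat) (n : 'I_p -> nat) (A : forall m : 'I_p, 'M[C]_(n m))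
  : 'M[C]_(tdim n) :=
  \matrix_(r, s) \prod_(m < p) mxentry (A m) (digit n r m) (digit n s m).

Definition product_dm (p : nat) (n : 'I_p -> nat) (B : 'M[C]_(tdim n)) : Prop :=
  exists A : forall m : 'I_p, 'M[C]_(n m),
    (forall m, density_matrix (A m)) /\ B = prod_mx A.

Definition convex_comb_of (N : nat) (P : 'M[C]_N -> Prop) (l : nat)
  (B : 'M[C]_N) : Prop :=
  exists (w : 'I_l -> R) (X : 'I_l -> 'M[C]_N),
    [/\ forall i, 0 <= w i, \sum_i w i = 1, forall i, P (X i)
      & B = \sum_i (Complex (w i) 0) *: X i].

Definition Sigma (p : nat) (n : 'I_p -> nat) : set 'M[C]_(tdim n) :=
  [set B | exists l, convex_comb_of (@product_dm p n) l B].

Definition Sigma_k (p : nat) (n : 'I_p -> nat) (k : nat) : set 'M[C]_(tdim n) :=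
  [set B | exists l, (l <= k)%N /\ convex_comb_of (@product_dm p n) l B].

(** Real linear parametrisation of the Hermitian N x N matrices by real N x N
    matrices: diagonal = X i i, entry (i,j) with i<j = X i j + i X j i. It is a
    linear bijection onto the Hermitian matrices, so the Euclidean topology of
    the Hermitian matrices is the one transported from 'M[R]_N. *)
Definition herm_of (N : nat) (X : 'M[R]_N) : 'M[C]_N :=
  \matrix_(i, j)
    if i == j then Complex (X i i) 0
    else if (i < j)%N then Complex (X i j) (X j i)
    else Complex (X j i) (- X i j).

Definition hcoords (N : nat) (S : set 'M[C]_N) : set 'M[R]_N :=
  [set X | S (herm_of X)].

Definition tau1 (N : nat) : set 'M[R]_N := [set X | \tr X = 1].

(** affine coordinates on tau_1(N): all entries of X except X 0 0,
    which is determined by the trace condition: R^(N^2-1) ~ tau_1(N) *)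
Definition coordT (N : nat) :=
  {ij : 'I_N * 'I_N | (ij.1 != ij.2) || (0 < ij.1)%N}.

Definition tau_coord (N : nat) (y : coordT N -> R) : 'M[R]_N :=
  \matrix_(i, j)
    match (insub (i, j) : option (coordT N)) with
    | Some t => y t
    | None => 1 - \sum_(t : coordT N | (val t).1 == (val t).2) y t
    end.

Definition null_set (T : finType) (E : set (T -> R)) : Prop :=
  forall eps : R, 0 < eps ->
    exists a b : nat -> T -> R,
      [/\ forall q t, a q t <= b q t,
          E `<=` \bigcup_q [set x | forall t, a q t <= x t <= b q t]
        & forall M, \sum_(q < M) \prod_(t : T) (b q t - a q t) < eps].

Definition tau_null (N : nat) (S : set 'M[C]_N) : Prop :=
  null_set [set y : coordT N -> R | S (herm_of (tau_coord y))].

End Defs.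

(* Main.v *)
Require Import Defs.
From HB Require Import structures.
From mathcomp Require Import all_boot all_order all_algebra.
From mathcomp Require Import all_classical all_reals all_analysis.
From mathcomp.real_closed Require Import complex.
From mathcomp Require Import measurable_realfun ring lra.
Import numFieldNormedType.Exports.
Import Order.TTheory GRing.Theory Num.Theory.
Local Open Scope ring_scope.
Local Open Scope classical_set_scope.

(** Compactness and connectedness hold because the set of length-k mixtures is
    the continuous image of a compact convex set of weights and factors.

    Group the first p factors into one of dimension M and let q be the last
    dimension. Expanding a mixture of k terms in real Hermitian bases of the two
    sides gives a real M^2 x q^2 matrix of rank at most k, with the entry at the
    two trace coordinates equal to 1. If k < M^2, some row (not that of the
    trace) is a combination, with bounded coefficients, of the others; since
    M <= q this displays the mixtures as finitely many Lipschitz images of cubes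
    of dimension at most N^2 - 2, which are null. (Counting the parameters of
    the mixed factors directly would not suffice.)

    If k >= M^2, choose M^2 product states D_x whose complex span is the whole
    matrix algebra of dimension M^2. Every Hermitian perturbation of
    sum_x D_x (x) a I is of the form sum_x D_x (x) B_x with B_x Hermitian and
    close to a I, hence positive, so a neighbourhood of this point consists of
    mixtures of the M^2 product states D_x (x) B_x / tr B_x. *)

(** * Null sets through finite covers *)

Definition vol (R : realType) (T : finType) (c : (T -> R) * (T -> R)) : R :=
  \prod_(t : T) (c.2 t - c.1 t).

Definition in_box (R : realType) (T : finType) (c : (T -> R) * (T -> R))
  (x : T -> R) : bool := [forall t, c.1 t <= x t <= c.2 t].

(** This is Jordan content zero. Finite lists are preferred to sequences of boxes because a union of
    two covers is then a concatenation. *)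
Definition finitely_null (R : realType) (T : finType) (E : set (T -> R)) : Prop :=
  forall eps : R, 0 < eps -> exists s : seq ((T -> R) * (T -> R)),
    [/\ forall c, List.In c s -> forall t, c.1 t <= c.2 t,
        forall x, E x -> exists2 c, List.In c s & in_box R T c x
      & \sum_(c <- s) vol R T c < eps].

Lemma finitely_null_sub (R : realType) (T : finType) (E F : set (T -> R)) :
  E `<=` F -> finitely_null R T F -> finitely_null R T E.
Proof.
move=> EF nF eps /nF[s [s1 s2 s3]]; exists s; split => // x /EF.
exact: s2.
Qed.

Lemma finitely_null_bigcup (R : realType) (T I : finType) (E : I -> set (T -> R)) :
  (forall i, finitely_null R T (E i)) ->
  finitely_null R T [set x | exists i, E i x].
Proof.
move=> nE.
suff H (r : seq I) : finitely_null R T [set x | exists2 i, i \in r & E i x].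
  apply: finitely_null_sub (H (enum I)) => x [i Ei]; exists i => //.
  by rewrite mem_enum.
elim: r => [|i r IH] eps eps0.
  by exists [::]; split; [| move=> x [] | rewrite big_nil].
have e2 : 0 < eps / 2 by rewrite divr_gt0.
have [s [s1 s2 s3]] := nE i _ e2; have [s' [s1' s2' s3']] := IH _ e2.
exists (s ++ s'); split.
- by move=> c /List.in_app_iff [ /s1 | /s1' ].
- move=> x [j]; rewrite inE => /predU1P[-> /s2 [c cs xc]|jr Ej].
    by exists c => //; apply/List.in_app_iff; left.
  have [|c] := s2' x; first by exists j.
  by exists c => //; apply/List.in_app_iff; right.
- by rewrite big_cat /= (splitr eps) ltrD.
Qed.

(** The list is continued by a degenerate box, whose volume vanishes as soon as there is a
    coordinate, so no partial sum exceeds the sum over the list. *)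
Lemma null_set_finitely_null (R : realType) (T : finType) (E : set (T -> R)) :
  (0 < #|T|)%N -> finitely_null R T E -> @Defs.null_set R T E.
Proof.
move=> T0 nE eps eps0; have [s [s1 s2 s3]] := nE eps eps0.
pose c0 : (T -> R) * (T -> R) := (fun=> 0, fun=> 0).
have nthP q : forall t, (nth c0 s q).1 t <= (nth c0 s q).2 t.
  case: (ltnP q (size s)) => [qs|qs]; last by rewrite nth_default.
  apply: s1; elim: {s2 s3} s q qs => //= c s IH [_|q /IH]; by [left|right].
exists (fun q => (nth c0 s q).1), (fun q => (nth c0 s q).2); split.
- by move=> q; exact: nthP.
- move=> x /s2[c cs xc].
  have [q qE] : exists q, nth c0 s q = c.
    elim: {s1 s2 s3 nthP} s cs => //= d s IH [->|/IH[q <-]]; first by exists 0%N.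
    by exists q.+1.
  by exists q => //= t; rewrite qE; exact: (forallP xc).
- move=> M; apply: le_lt_trans s3; rewrite (big_nth c0) big_mkord.
  pose F q := vol R T (nth c0 s q).
  have F0 q : 0 <= F q by apply: prodr_ge0 => t _; rewrite subr_ge0.
  have Fs q : (size s <= q)%N -> F q = 0.
    move=> qs; rewrite /F nth_default // /vol.
    have /card_gt0P[t _] := T0.
    by rewrite (bigD1 t) //= subrr mul0r.
  case: (leqP M (size s)) => [Ms|sM].
    rewrite -(subnKC Ms) big_split_ord /= lerDl; apply: sumr_ge0 => i _; exact: F0.
  rewrite -(subnKC (ltnW sM)) big_split_ord /= [X in _ + X]big1 ?addr0 //.
  by move=> i _; apply: Fs; rewrite leq_addr.
Qed.

(** * Lipschitz images of cubes of smaller dimension *)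

Definition dist_le (R : realType) (T : finType) (d : R) (x y : T -> R) : Prop :=
  forall t, `|x t - y t| <= d.

(** The cube of side 2K is cut into m^|S| cubes of side h = 2K/m. Each image lies in a box of side
    2Lh, so the total volume is m^|S| (4LK/m)^|T|, which is at most C/m because |S| < |T|. *)
Lemma finitely_null_lipschitz (R : realType) (S T : finType)
    (f : (S -> R) -> (T -> R)) (K L : R) :
  (#|S| < #|T|)%N -> 0 < K -> 0 <= L ->
  (forall d x y, 0 <= d -> dist_le R S K x (fun=> 0) -> dist_le R S K y (fun=> 0) ->
     dist_le R S d x y -> dist_le R T (L * d) (f x) (f y)) ->
  finitely_null R T [set z | exists2 x, dist_le R S K x (fun=> 0) & z = f x].
Proof.
move=> ST K0 L0 fL eps eps0.
pose C := (4 * L * K) ^+ #|T|.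
have C0 : 0 <= C by apply: exprn_ge0; rewrite !mulr_ge0 // ltW.
pose m := (Num.truncn (C / eps)).+1.
have Cm : C / eps < m%:R by apply: truncnS_gt.
have m0 : 0 < m%:R :> R by rewrite ltr0n.
pose h := 2 * K / m%:R.
have h0 : 0 < h by rewrite !mulr_gt0 ?invr_gt0.
pose corner (g : {ffun S -> 'I_m}) (s : S) : R := - K + (g s)%:R * h.
have cornerK g : dist_le R S K (corner g) (fun=> 0).
  move=> s; rewrite /corner subr0 ler_norml lerDl.
  rewrite (mulr_ge0 (ler0n _ _) (ltW h0)) /=.
  rewrite addrC lerBlDr -mulr2n -(mulr_natl K) /h mulrA ler_pdivrMr // mulrC.
  by rewrite ler_pM2l ?mulr_gt0 // ler_nat ltnW.
pose box g := (fun t => f (corner g) t - L * h, fun t => f (corner g) t + L * h).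
exists [seq box g | g <- enum {ffun S -> 'I_m}]; split.
- move=> c /List.in_map_iff[g [<- _]] t /=.
  by have := mulr_ge0 L0 (ltW h0); lra.
- move=> z [x xK ->].
  have ex s : exists i : 'I_m, `|x s - (- K + i%:R * h)| <= h.
    have := xK s; rewrite subr0 ler_norml => /andP[xl xr].
    pose u := (x s + K) / h.
    have u0 : 0 <= u by rewrite divr_ge0 ?(ltW h0) // -lerBlDr sub0r.
    have um : u <= m%:R.
      rewrite ler_pdivrMr // /h mulrC divfK ?lt0r_neq0 // mulr_natl mulr2n.
      by rewrite lerD2r.
    have xE : x s = - K + u * h by rewrite /u divfK ?lt0r_neq0 // addrCA addNr addr0.
    (* The minimum matters only at the right end u = m, where truncation would give an index out of
       range; the distance to the last corner is then exactly h. *)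
    pose j := minn (Num.truncn u) m.-1.
    have jm : (j < m)%N by rewrite /j gtn_min /= ltnSn orbT.
    exists (Ordinal jm) => /=; rewrite xE opprD addrACA subrr add0r -mulrBl.
    rewrite normrM (gtr0_norm h0) ler_piMl ?(ltW h0) // ler_norml.
    have := truncn_itv u0 => /andP[t1 t2].
    have [tm|tm] := leqP (Num.truncn u) m.-1.
      rewrite /j (minn_idPl tm); move: t1 t2; rewrite -natr1; lra.
    rewrite /j (minn_idPr (ltnW tm)).
    have mE : m%:R = m.-1%:R + 1 :> R by rewrite natr1.
    have : m.-1%:R <= u by apply: le_trans t1; rewrite ler_nat ltnW.
    by move: um; rewrite mE; lra.
  have /fin_all_exists[g gP] := ex.
  exists (box [ffun s => g s]).
    apply/List.in_map_iff; exists [ffun s => g s]; split => //.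
    have: [ffun s => g s] \in enum {ffun S -> 'I_m} by rewrite mem_enum.
    elim: (enum _) => //= a l IH; rewrite inE => /predU1P[->|/IH]; by [left|right].
  apply/forallP => t /=.
  have xg : dist_le R S h x (corner [ffun s => g s]).
    by move=> s; rewrite /corner ffunE.
  have := fL h x _ (ltW h0) xK (cornerK [ffun s => g s]) xg t.
  rewrite ler_norml; lra.
- rewrite big_map (eq_bigr (fun=> (2 * L * h) ^+ #|T|)); last first.
    move=> g _; rewrite /vol /= (eq_bigr (fun=> 2 * L * h)) ?prodr_const //.
    by move=> t _; lra.
  rewrite big_const_seq count_predT iter_addr_0 -cardE card_ffun card_ord.
  rewrite -[_ *+ _]mulr_natl natrX.
  have -> : 2 * L * h = (4 * L * K) / m%:R by rewrite /h; field; rewrite lt0r_neq0.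
  rewrite exprMn -/C exprVn.
  (* The exponent |T| is split as d + |S| + 1: the |S| factors cancel the number of boxes, one
     factor makes C/m small, and the remaining d only help. *)
  rewrite -(subnK ST) addnS exprS exprD invfM.
  set d := (_ - _)%N.
  have mS0 : m%:R ^+ #|S| != 0 :> R by rewrite expf_neq0 // lt0r_neq0.
  rewrite [X in _ * X](_ : _ = C / m%:R / m%:R ^+ d / m%:R ^+ #|S|); last first.
    by rewrite invfM; ring.
  rewrite mulrC divfK //.
  apply: (@le_lt_trans _ _ (C / m%:R)).
    have Cm0 : 0 <= C / m%:R by apply: divr_ge0 => //; exact: ltW.
    by rewrite ler_pdivrMr ?exprn_gt0 // ler_peMr // exprn_ege1 // ler1n.
  by rewrite ltr_pdivrMr // mulrC -ltr_pdivrMr.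
Qed.

(** * Matrices of low rank *)

Lemma card_compl2 (T : finType) (a b : T) : a != b ->
  (#|{: {s : T | (s != a) && (s != b)}}|.+2 = #|T|)%N.
Proof.
move=> ab; rewrite card_sig.
rewrite -cardsT (cardsD1 a) (cardsD1 b) !inE eq_sym ab /= add1n; do 2 congr S.
by apply: eq_card => s; rewrite !inE andbT andbC.
Qed.

Definition row_subst (R : realType) (A B : finType) (r : A) (iota : A -> B)
    (X : A * B -> R) (a : A) (b : B) : R :=
  if a == r then \sum_(a' | a' != r) X (r, iota a') * X (a', b) else X (a, b).

(** Default value 1: of the two entries later removed from the parameters, one is the entry at the
    trace coordinates, equal to 1, and the other is never read by [row_subst]. *)
Definition extend1 (R : realType) (T : finType) (P : pred T)
  (x : {s : T | P s} -> R) (s : T) : R := oapp x 1 (insub s).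

Lemma row_subst_lipschitz (R : realType) (A B : finType) (r : A) (iota : A -> B)
    (X Y : A * B -> R) (K d : R) : 0 <= K -> 0 <= d ->
  (forall s, `|X s| <= K) -> (forall s, `|Y s| <= K) ->
  (forall s, `|X s - Y s| <= d) ->
  forall a b, `|row_subst R A B r iota X a b - row_subst R A B r iota Y a b|
    <= (1 + 2 * K * #|A|%:R) * d.
Proof.
move=> K0 d0 XK YK XY a b; rewrite /row_subst.
have c0 : 0 <= 2 * K * #|A|%:R * d by rewrite !mulr_ge0.
case: ifP => _; last by apply: le_trans (XY _) _; rewrite mulrDl mul1r lerDl.
rewrite -sumrB; apply: le_trans (ler_norm_sum _ _ _) _.
apply: (@le_trans _ _ (\sum_(a' : A) 2 * K * d)).
  rewrite big_mkcond; apply: ler_sum => i _; case: ifP => _; last first.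
    by rewrite !mulr_ge0.
  rewrite (_ : _ - _ = (X (r, iota i) - Y (r, iota i)) * X (i, b)
     + Y (r, iota i) * (X (i, b) - Y (i, b))); last by ring.
  apply: le_trans (ler_normD _ _) _; rewrite !normrM.
  have h1 : `|X (r, iota i) - Y (r, iota i)| * `|X (i, b)| <= d * K by apply: ler_pM.
  have h2 : `|Y (r, iota i)| * `|X (i, b) - Y (i, b)| <= K * d by apply: ler_pM.
  lra.
rewrite sumr_const -[_ *+ _]mulr_natl mulrDl mul1r; lra.
Qed.

(* A matrix of rank less than its number of rows has a row other than [a0] that
   is a combination, with bounded coefficients, of the other rows. Its entries
   are free to store these coefficients, the one of row [a] in column [iota a]. *)
Lemma finitely_null_low_rank (R : realType) (A B T : finType) (a0 : A) (b0 : B)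
    (k : nat) (K : R) (phi : T -> A -> B -> R) :
  (#|T|.+1 = #|A| * #|B|)%N -> (#|A| <= #|B|)%N -> (k < #|A|)%N ->
  finitely_null R T [set y | exists (w : 'I_k -> R) (u : 'I_k -> A -> R)
      (v : 'I_k -> B -> R),
    [/\ forall i, 0 <= w i, \sum_i w i = 1,
        forall i, u i a0 = 1 /\ v i b0 = 1,
        forall i a b, `|u i a| <= K /\ `|v i b| <= K
      & y = fun t => \sum_a \sum_b (\sum_i w i * u i a * v i b) * phi t a b]].
Proof.
move=> Tcard AB kA.
pose iota (a : A) : B := enum_val (widen_ord AB (enum_rank a)).
have iota_inj : injective iota.
  by move=> a a' /enum_val_inj/(congr1 val)/= /ord_inj/enum_rank_inj.
(* Dropping the trace entry and the unread entry [(r, iota r)] leaves |A||B| - 2 = |T| - 1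
   parameters, one less than the dimension of the target. *)
pose P (r : A) := [pred s : A * B | (s != (a0, b0)) && (s != (r, iota r))].
pose f (r : A) (x : {s | P r s} -> R) (t : T) :=
  \sum_a \sum_b row_subst R A B r iota (extend1 R _ (P r) x) a b * phi t a b.
(* This bounds at once the default value 1, the entries of the mixed matrix (at most K^2) and the
   stored coefficients (at most 1 or |K||A|). *)
pose K' := 1 + K ^+ 2 + `|K| * #|A|%:R.
have K'0 : 0 < K'.
  have := sqr_ge0 K; have : 0 <= `|K| * #|A|%:R by apply: mulr_ge0.
  by rewrite /K'; lra.
have K'1 : 1 <= K'.
  have := sqr_ge0 K; have : 0 <= `|K| * #|A|%:R by apply: mulr_ge0.
  by rewrite /K'; lra.
(* The redundant row is not known beforehand, so there is one Lipschitz image for each candidate [r]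
   other than [a0]. *)
apply: (@finitely_null_sub _ _ _ [set y | exists r : {r : A | r != a0},
  [set z | exists2 x, dist_le R _ K' x (fun=> 0) & z = f (val r) x] y]); last first.
  apply: finitely_null_bigcup => -[r ra0] /=.
  pose L := (1 + 2 * K' * #|A|%:R) * \sum_t \sum_a \sum_b `|phi t a b|.
  apply: (@finitely_null_lipschitz _ _ _ (f r) K' L) => //.
  - rewrite -ltnS Tcard -card_prod -(@card_compl2 _ (a0, b0) (r, iota r)) //.
    by rewrite xpair_eqE eq_sym (negbTE ra0).
  - apply: mulr_ge0; first by rewrite addr_ge0 // !mulr_ge0 // ltW.
    by do 3 (apply: sumr_ge0 => ? _).
  - move=> d x y d0 xK yK xy t.
    have extK z : dist_le R _ K' z (fun=> 0) ->
        forall s, `|extend1 R _ (P r) z s| <= K'.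
      move=> zK s; rewrite /extend1; case: insubP => [s' _ _|_] /=.
        by rewrite -[z s']subr0; exact: zK.
      by rewrite normr1.
    rewrite /f -sumrB; apply: le_trans (ler_norm_sum _ _ _) _.
    rewrite /L mulrAC mulr_sumr.
    have cd0 : 0 <= (1 + 2 * K' * #|A|%:R) * d.
      by rewrite mulr_ge0 // addr_ge0 // !mulr_ge0 // ltW.
    rewrite (bigD1 t) //= -[X in X <= _]addr0; apply: lerD; last first.
      by apply: sumr_ge0 => ? _; rewrite mulr_ge0 //; do 2 (apply: sumr_ge0 => ? _).
    rewrite mulr_sumr; apply: ler_sum => a _.
    rewrite -sumrB mulr_sumr; apply: le_trans (ler_norm_sum _ _ _) _.
    apply: ler_sum => b _; rewrite -mulrBl normrM ler_wpM2r //.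
    apply: row_subst_lipschitz; rewrite ?(ltW K'0) //; [exact: extK|exact: extK|].
    move=> s; rewrite /extend1; case: insubP => [s' _ _|_] /=; first exact: xy.
    by rewrite subrr normr0.
move=> y [w [u [v [w0 w1 uv1 uvK ->]]]].
(* The mixed matrix factors through [U], which has fewer columns than rows; a left kernel vector of
   [U] is therefore a relation between the rows of the mixture. *)
pose U : 'M[R]_(#|A|, k) := \matrix_(a, i) u i (enum_val a).
have /rowV0Pn[psi /sub_kermxP psiU psi0] : kermx U != 0.
  rewrite -mxrank_eq0 mxrank_ker subn_eq0 -ltnNge.
  exact: leq_ltn_trans (rank_leq_col _) kA.
pose p a : R := psi 0 (enum_rank a).
have pu i : \sum_a p a * u i a = 0.
  have /matrixP/(_ 0 i) := psiU; rewrite !mxE => E0; rewrite -[RHS]E0 {E0}.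
  rewrite [RHS](reindex (@enum_rank A)) /=; last exact/onW_bij/enum_rank_bij.
  apply: eq_bigr => a _.
  by rewrite mxE /p enum_rankK.
have k0 : (0 < k)%N.
  rewrite lt0n; apply/eqP => k0; move: w1; rewrite big1 => [/esym/eqP|i].
    by rewrite oner_eq0.
  by have := ltn_ord i; rewrite {2}k0.
(* Since [u i a0 = 1], the relation controls the coefficient at [a0] by the others; this is what
   allows a pivot row different from that of the trace. *)
have pa0 : `|p a0| <= \sum_(a | a != a0) `|p a| * `|K|.
  have := pu (Ordinal k0); rewrite (bigD1 a0) //= (uv1 _).1 mulr1.
  move/eqP; rewrite addr_eq0 => /eqP ->; rewrite normrN.
  apply: le_trans (ler_norm_sum _ _ _) _; apply: ler_sum => a _.
  rewrite normrM ler_wpM2l //.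
  have [+ _] := uvK (Ordinal k0) a b0; move/le_trans; apply; exact: ler_norm.
have [a1 pa1] : exists a, p a != 0.
  move/rV0Pn: psi0 => [j pj]; exists (enum_val j); by rewrite /p enum_valK.
have [a2 a20] : exists a, a != a0.
  apply/existsP; rewrite -[[exists _, _]]negbK negb_exists; apply/negP => /forallP Ha.
  move: pa1; have /eqP -> : a1 == a0 by rewrite -[_ == _]negbK; exact: Ha.
  move: pa0; rewrite big_pred0 ?normr_le0 => [/eqP ->|a]; first by rewrite eqxx.
  by apply/negbTE; exact: Ha.
(* Dividing by the largest coefficient outside [a0] keeps the quotients bounded by 1 there, and by
   |K||A| at [a0]. *)
pose r := [arg max_(a > a2 | a != a0) `|p a|]%O.
have [ra0 rmax] : r != a0 /\ forall a, a != a0 -> `|p a| <= `|p r|.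
  by rewrite /r; case: arg_maxP => // i i0 H; split.
have pa0r : `|p a0| <= `|K| * #|A|%:R * `|p r|.
  apply: le_trans pa0 _.
  apply: (@le_trans _ _ (\sum_(a : A) `|p r| * `|K|)).
    rewrite big_mkcond; apply: ler_sum => a _; case: ifP => [/rmax H|_].
      by rewrite ler_wpM2r.
    exact: mulr_ge0.
  by rewrite sumr_const -[_ *+ _]mulr_natl le_eqVlt; apply/orP; left; apply/eqP; ring.
have pr0 : p r != 0.
  apply/eqP => pr; move: pa1; have [->|/rmax] := eqVneq a1 a0.
    by move: pa0r; rewrite pr normr0 mulr0 normr_le0 => ->.
  by rewrite pr normr0 normr_le0 => ->.
pose c a := - (p a / p r).
have cK a : `|c a| <= K'.
  rewrite /c normrN normrM normfV ler_pdivrMr ?normr_gt0 //.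
  have K2 := sqr_ge0 K; have pr' := normr_ge0 (p r).
  have KA : 0 <= `|K| * #|A|%:R by apply: mulr_ge0.
  have [->|/rmax H] := eqVneq a a0.
    by apply: le_trans pa0r _; rewrite ler_wpM2r // /K'; lra.
  by apply: le_trans H _; rewrite -[X in X <= _]mul1r ler_wpM2r.
have ur i : u i r = \sum_(a | a != r) c a * u i a.
  apply: (mulfI pr0); have := pu i; rewrite (bigD1 r) //= => /eqP.
  rewrite addr_eq0 => /eqP ->; rewrite mulr_sumr -sumrN; apply: eq_bigr => a _.
  by rewrite /c; field.
pose Z a b := \sum_i w i * u i a * v i b.
have ZK a b : `|Z a b| <= K'.
  apply: le_trans (ler_norm_sum _ _ _) _.
  apply: (@le_trans _ _ (\sum_i w i * K ^+ 2)).
    apply: ler_sum => i _; rewrite !normrM (ger0_norm (w0 _)) -mulrA ler_wpM2l //.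
    by have [? ?] := uvK i a b; rewrite expr2 ler_pM.
  have KA : 0 <= `|K| * #|A|%:R by apply: mulr_ge0.
  by rewrite -mulr_suml w1 mul1r /K'; lra.
(* The parameters are the entries of the mixture outside row [r] and the coefficients in row [r],
   with 0 in the columns that [iota] misses. *)
pose X (s : A * B) : R :=
  if s.1 == r then oapp c 0 [pick a | iota a == s.2] else Z s.1 s.2.
have XK s : `|X s| <= K'.
  rewrite /X; case: ifP => // _; case: pickP => [a _|_] //=.
  by rewrite normr0 ltW.
pose x (s : {s | P r s}) := X (val s).
have xZ a b : a != r -> extend1 R _ (P r) x (a, b) = Z a b.
  move=> ar; rewrite /extend1; case: insubP => [s _ sE|] /=.
    by rewrite /x sE /X /= (negbTE ar).
  rewrite negb_and !negbK => /orP[] /eqP[aE bE]; last by rewrite aE eqxx in ar.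
  by rewrite aE bE /Z -w1; apply: eq_bigr => i _; have [-> ->] := uv1 i; rewrite !mulr1.
have xc a : a != r -> extend1 R _ (P r) x (r, iota a) = c a.
  move=> ar; rewrite /extend1 insubT /=.
    rewrite !xpair_eqE (negbTE ra0) eqxx /=; apply: contra ar => /eqP/iota_inj ->.
    exact: eqxx.
  move=> H; rewrite /x /X /= eqxx; case: pickP => [a' /eqP/iota_inj ->//|].
  by move/(_ a); rewrite eqxx.
exists (Sub r ra0); exists x => [s|]; first by rewrite subr0; exact: XK.
apply/funext => t; apply: eq_bigr => a _; apply: eq_bigr => b _; congr (_ * _).
change (Z a b = row_subst R A B r iota (extend1 R _ (P r) x) a b).
rewrite /row_subst; have [ar|ar] := boolP (a == r); last by rewrite xZ.
move/eqP: ar => ->.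
rewrite (eq_bigr (fun a' => c a' * Z a' b)); last by move=> a' ar; rewrite xc ?xZ.
rewrite /Z (eq_bigr (fun i => \sum_(a' | a' != r) c a' * (w i * u i a' * v i b))).
  by rewrite exchange_big; apply: eq_bigr => a' _; rewrite mulr_sumr.
move=> i _; rewrite ur mulr_sumr mulr_suml; apply: eq_bigr => a' _; ring.
Qed.

(** * Boxes are not null *)

(** The pointwise inequality is integrated over [c, d]. The terms being nonnegative, sum and
    integral commute, and each indicator integrates to at most the length of its interval. *)
Lemma interval_cover_ge (R : realType) (V c d : R) (g a b : nat -> R) :
  0 <= V -> c <= d -> (forall q, 0 <= g q) -> (forall q, a q <= b q) ->
  (forall z, c <= z <= d ->
     (V%:E <= \sum_(0 <= q <oo) (g q * (a q <= z <= b q)%R%:R)%:E)%E) ->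
  ((V * (d - c))%:E <= \sum_(0 <= q <oo) (g q * (b q - a q))%:E)%E.
Proof.
move=> V0 cd g0 ab cover.
have itvE (x y z : R) : (x <= z <= y)%R%:R = \1_(`[x, y]) z :> R.
  by rewrite indicE mem_setE in_itv.
have muE (x y : R) : x <= y -> (@lebesgue_measure R) `[x, y] = (y - x)%:E.
  move=> xy; rewrite lebesgue_measure_itv /= lte_fin.
  by case: ltgtP xy => // ->; rewrite subrr.
have mf q : measurable_fun (`[c, d] : set R)
      (EFin \o (fun z : R => g q * (a q <= z <= b q)%R%:R)).
  apply/measurable_EFinP; apply: measurable_funM; first exact: measurable_cst.
  rewrite (_ : (fun z : R => _) = \1_(`[a q, b q])); last by apply/funext => z; exact: itvE.
  exact: measurable_indic.
have f0 q (z : R) : `[c, d] z -> (0 <= (g q * (a q <= z <= b q)%R%:R)%:E)%E.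
  by move=> _; rewrite lee_fin mulr_ge0.
rewrite EFinM -muE // -integral_cst //.
apply: (@le_trans _ _ (\int[lebesgue_measure]_(z in `[c, d])
    \sum_(0 <= q <oo) (g q * (a q <= z <= b q)%R%:R)%:E)%E).
  apply: ge0_le_integral => //.
  by apply: ge0_emeasurable_sum => [q z zcd _|q _]; [exact: f0|exact: mf].
rewrite integral_nneseries; [|by []|by []|by []].
apply: lee_nneseries => [q _ _|q _].
  by apply: integral_ge0 => z; exact: f0.
rewrite EFinM -muE //.
under eq_integral do rewrite EFinM.
rewrite ge0_integralZl //.
- apply: lee_wpmul2l; first by rewrite lee_fin.
  under eq_integral do rewrite itvE.
  rewrite integral_indic //; apply: le_measure => //; rewrite ?inE //.
  exact: measurableI.
- apply/measurable_EFinP.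
  rewrite (_ : (fun z : R => _) = \1_(`[a q, b q])); last by apply/funext => z; exact: itvE.
  exact: measurable_indic.
- by rewrite lee_fin.
Qed.

(** One coordinate is integrated out at a time, which replaces a product measure. The general [V]
    and [w] make the induction work: they absorb the side lengths of the coordinates already
    treated. *)
Lemma box_cover_ge (R : realType) (T : eqType) (s : seq T) (V : R) (w : nat -> R)
    (c d : T -> R) (a b : nat -> T -> R) :
  uniq s -> 0 <= V -> (forall q, 0 <= w q) -> (forall t, c t <= d t) ->
  (forall q t, a q t <= b q t) ->
  (forall x : T -> R, (forall t, c t <= x t <= d t) ->
    (V%:E <= \sum_(0 <= q <oo)
      (w q * \prod_(t <- s) (a q t <= x t <= b q t)%R%:R)%:E)%E) ->
  ((V * \prod_(t <- s) (d t - c t))%:E <=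
     \sum_(0 <= q <oo) (w q * \prod_(t <- s) (b q t - a q t))%:E)%E.
Proof.
move=> + + + cd ab; elim: s V w => [|t s IH] V w us V0 w0 cover.
  rewrite big_nil mulr1.
  apply: le_trans (cover c _) _; first by move=> t; rewrite lexx cd.
  rewrite le_eqVlt; apply/orP; left; apply/eqP; apply: eq_eseriesr => q _.
  by rewrite !big_nil.
rewrite big_cons mulrA; under eq_eseriesr => ? _ do rewrite big_cons mulrA.
move: us => /= /andP[ts us].
apply: IH => //.
- by rewrite mulr_ge0 // subr_ge0.
- by move=> q; rewrite mulr_ge0 // subr_ge0.
move=> x xcd.
under eq_eseriesr => ? _ do rewrite mulrAC.
apply: interval_cover_ge => // [q|z zcd].
  by rewrite mulr_ge0 // prodr_ge0.
(* Only the coordinate [t] moves, and by uniqueness it does not occur among the coordinates that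
   remain. *)
pose x' u := if u == t then z else x u.
have := cover x'; move=> /(_ _)/le_trans; apply.
  by move=> u; rewrite /x'; case: eqP => // ->.
rewrite le_eqVlt; apply/orP; left; apply/eqP; apply: eq_eseriesr => q _.
rewrite big_cons /x' eqxx mulrAC -mulrA; congr (_ * (_ * _))%:E.
rewrite !big_seq; apply: eq_bigr => u us'; case: eqP => // uE.
by rewrite uE (negbTE ts) in us'.
Qed.

(** A cover of the cube has total volume at least that of the cube. Half of this volume is taken as
    the tolerance, since in the limit the bound on partial sums is no longer strict. *)
Lemma null_set_no_box (R : realType) (T : finType) (E : set (T -> R)) (y : T -> R)
    (d : R) : 0 < d ->
  (forall x, (forall t, `|x t - y t| <= d) -> E x) -> ~ @Defs.null_set R T E.
Proof.
move=> d0 yE nE.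
have e0 : 0 < \prod_(t : T) (2 * d) by apply: prodr_gt0 => t _; rewrite mulr_gt0.
have e1 : 0 < (\prod_(t : T) (2 * d)) / 2 by rewrite divr_gt0.
have [a [b [ab Eab sumab]]] := nE _ e1.
have : (((1 : R) * \prod_(t <- enum T) ((y t + d) - (y t - d)))%:E <=
   \sum_(0 <= q <oo) ((1 : R) * \prod_(t <- enum T) (b q t - a q t))%:E)%E.
  apply: (@box_cover_ge R T (enum T) 1 (fun=> 1) (fun t => y t - d) (fun t => y t + d)) => //.
  - exact: enum_uniq.
  - by move=> t; lra.
  move=> x xy; have [|q _ xq] := Eab x.
    by apply: yE => t; have := xy t; rewrite ler_norml; lra.
  (* The term of the one box containing [x] already equals 1. *)
  apply: le_trans (nneseries_lim_ge q.+1 _); last first.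
    by move=> i _ _; rewrite lee_fin mulr_ge0 // prodr_ge0.
  rewrite big_nat_recr //= [X in (_ <= _ + X)%E](_ : _ = 1%E).
    rewrite -[X in (X <= _)%E]add0e leeD2r // sume_ge0 // => i _.
    by rewrite lee_fin mulr_ge0 // prodr_ge0.
  by rewrite mul1r big1 // => t _; rewrite xq.
rewrite mul1r big_enum /= (eq_bigr (fun=> 2 * d)); last by move=> t _; lra.
apply/negP; rewrite -ltNge.
apply: (@le_lt_trans _ _ ((\prod_(t : T) (2 * d)) / 2)%:E); last first.
  by rewrite lte_fin; lra.
apply: lime_le.
  by apply: is_cvg_nneseries => q _ _; rewrite lee_fin mulr_ge0 // prodr_ge0 // => t _; rewrite subr_ge0.
apply: nearW => M; rewrite sumEFin lee_fin big_mkord.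
apply: le_trans (ltW (sumab M)); apply: ler_sum => q _.
by rewrite mul1r big_enum.
Qed.

(** * Entries of product matrices and real coordinates *)

(** Entries of a product matrix at natural number indices, so that quotients and remainders can be
    taken without transporting ordinals between dimensions. *)
Definition entry_prod (R : realType) (p : nat) (n : 'I_p -> nat)
    (A : forall m, 'M[R[i]]_(n m)) (r s : nat) : R[i] :=
  \prod_(m < p) mxentry (A m) (digit n r m) (digit n s m).

Definition front (p : nat) (n : 'I_p.+1 -> nat) (m : 'I_p) : nat :=
  n (widen_ord (leqnSn p) m).

Definition front_mx (R : realType) (p : nat) (n : 'I_p.+1 -> nat)
    (A : forall m, 'M[R[i]]_(n m)) (m : 'I_p) : 'M[R[i]]_(front p n m) :=
  A (widen_ord (leqnSn p) m).

Lemma prod_mxE (R : realType) (p : nat) (n : 'I_p -> nat)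
    (A : forall m, 'M[R[i]]_(n m)) r s : prod_mx A r s = entry_prod R p n A r s.
Proof. by rewrite mxE. Qed.

Lemma tdim_front (p : nat) (n : 'I_p.+1 -> nat) :
  tdim n = (tdim (front p n) * n ord_max)%N.
Proof. by rewrite /tdim big_ord_recr. Qed.

Lemma front_prodE (p : nat) (n : 'I_p.+1 -> nat) :
  (\prod_(m < p.+1 | (m < p)%N) n m)%N = tdim (front p n).
Proof.
rewrite big_mkcond big_ord_recr /= ltnn muln1 /tdim; apply: eq_bigr => m _.
by rewrite ltn_ord.
Qed.

Lemma digit_front (p : nat) (n : 'I_p.+1 -> nat) (r : nat) (m : 'I_p) :
  digit n r (widen_ord (leqnSn p) m) = digit (front p n) (r %/ n ord_max) m.
Proof.
rewrite /digit big_mkcond big_ord_recr /= ltn_ord -divnMA mulnC; congr (_ %/ _ %% _)%N.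
by congr (_ * _)%N; rewrite [RHS]big_mkcond.
Qed.

Lemma digit_last (p : nat) (n : 'I_p.+1 -> nat) (r : nat) :
  digit n r ord_max = (r %% n ord_max)%N.
Proof.
rewrite /digit big_pred0 ?divn1 // => j /=; apply/negbTE; rewrite -leqNgt.
by rewrite -ltnS.
Qed.

(** The last factor is the least significant digit, so splitting it off is division with remainder
    by its dimension. All inductions on the number of factors go through this. *)
Lemma entry_prodS (R : realType) (p : nat) (n : 'I_p.+1 -> nat)
    (A : forall m, 'M[R[i]]_(n m)) (r s : nat) :
  entry_prod R p.+1 n A r s =
  entry_prod R p (front p n) (front_mx R p n A) (r %/ n ord_max) (s %/ n ord_max)
  * mxentry (A ord_max) (r %% n ord_max) (s %% n ord_max).
Proof.
rewrite /entry_prod big_ord_recr /= !digit_last; congr (_ * _).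
by apply: eq_bigr => m _; rewrite !digit_front.
Qed.

Lemma sum_mul_digits (V : nmodType) (M q : nat) (f : nat -> V) :
  (\sum_(0 <= r < M * q) f r = \sum_(0 <= i < M) \sum_(0 <= j < q) f (i * q + j)%N)%R.
Proof.
elim: M => [|M IH]; first by rewrite mul0n !big_geq.
rewrite big_nat_recr //= -IH mulSnr (big_cat_nat (n := (M * q)%N)) ?leq_addr //=.
congr (_ + _); rewrite -{1}[(M * q)%N]add0n big_addn addKn.
by apply: eq_bigr => j _; rewrite addnC.
Qed.

Lemma sum_mul_divmod (V : nmodType) (M q : nat) (f : nat -> nat -> V) :
  (\sum_(0 <= r < M * q) f (r %/ q)%N (r %% q)%N =
   \sum_(0 <= i < M) \sum_(0 <= j < q) f i j)%R.
Proof.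
rewrite sum_mul_digits; apply: eq_bigr => i _; apply: eq_big_nat => j /= jq.
have q0 : (0 < q)%N by apply: leq_ltn_trans jq.
by rewrite divnMDl // divn_small // addn0 modnMDl modn_small.
Qed.

Lemma entry_prod_trace (R : realType) (p : nat) (n : 'I_p -> nat)
    (A : forall m, 'M[R[i]]_(n m)) :
  \sum_(0 <= r < tdim n) entry_prod R p n A r r =
  \prod_m \sum_(0 <= i < n m) mxentry (A m) i i.
Proof.
elim: p n A => [|p IH] n A.
  by rewrite /tdim !big_ord0 big_nat1 /entry_prod big_ord0.
rewrite big_ord_recr /= -(IH _ (front_mx R p n A)) tdim_front.
under eq_bigr do rewrite entry_prodS.
rewrite (@sum_mul_divmod _ _ _ (fun i j => entry_prod R p (front p n) (front_mx R p n A) i i * mxentry (A ord_max) j j)).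
by rewrite mulr_suml; apply: eq_bigr => i _; rewrite mulr_sumr.
Qed.

Lemma mxentryE (R : realType) (d : nat) (A : 'M[R[i]]_d) (i j : 'I_d) :
  mxentry A i j = A i j.
Proof. by rewrite /mxentry !valK. Qed.

Lemma mxentry_trace (R : realType) (d : nat) (A : 'M[R[i]]_d) :
  \sum_(0 <= i < d) mxentry A i i = \tr A.
Proof. by rewrite big_mkord; apply: eq_bigr => i _; rewrite mxentryE. Qed.

(** * Hermitian matrices and their real coordinates *)

Lemma conjE (R : realType) (z : R[i]) : Num.conj z = Complex (complex.Re z) (- complex.Im z).
Proof. by case: z. Qed.

Lemma hermitian_conj (R : realType) (N : nat) (A : 'M[R[i]]_N) :
  Defs.hermitian A <-> forall i j, Num.conj (A i j) = A j i.
Proof.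
split=> [AH i j|AH]; first by rewrite -{2}AH !mxE.
by apply/matrixP => i j; rewrite !mxE AH.
Qed.

Lemma mxentry_conj (R : realType) (N : nat) (A : 'M[R[i]]_N) i j :
  Defs.hermitian A -> Num.conj (mxentry A i j) = mxentry A j i.
Proof.
move=> /hermitian_conj AH; rewrite /mxentry; case: insubP => [i' _ _|_]; case: insubP => [j' _ _|_] //.
all: by rewrite rmorph0.
Qed.

Lemma entry_prod_conj (R : realType) (p : nat) (n : 'I_p -> nat)
    (A : forall m, 'M[R[i]]_(n m)) r s : (forall m, Defs.hermitian (A m)) ->
  Num.conj (entry_prod R p n A r s) = entry_prod R p n A s r.
Proof.
by move=> AH; rewrite rmorph_prod; apply: eq_bigr => m _; rewrite /= mxentry_conj.
Qed.

(** Only the diagonal and the upper triangle are read, which makes this a left inverse of [herm_of]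
    and, on Hermitian matrices, a two-sided one. *)
Definition hermitian_coords (R : realType) (N : nat) (B : 'M[R[i]]_N) : 'M[R]_N :=
  \matrix_(i, j) if i == j then complex.Re (B i i)
                 else if (i < j)%N then complex.Re (B i j) else complex.Im (B j i).

Lemma herm_ofK (R : realType) (N : nat) : cancel (@herm_of R N) (hermitian_coords R N).
Proof.
move=> X; apply/matrixP => i j; rewrite !mxE eqxx; case: eqP => [->//|] /eqP ij.
by rewrite eq_sym (negbTE ij); case: ltngtP => //= /val_inj ji; rewrite ji eqxx in ij.
Qed.

Lemma hermitian_coordsK (R : realType) (N : nat) (B : 'M[R[i]]_N) :
  Defs.hermitian B -> herm_of (hermitian_coords R N B) = B.
Proof.
move=> /hermitian_conj BH; apply/matrixP => i j; rewrite !mxE eqxx.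
have := BH i j; have := BH j i; rewrite !conjE eq_sym.
case: eqP => [->|/eqP ij _ _].
  by move=> + _; case: (B i i) => a b /= [] bE; apply/eqP; rewrite eq_complex /= eqxx /=; apply/eqP; lra.
case: ltngtP => [_|_|/val_inj ji]; last by rewrite ji eqxx in ij.
  by case: (B i j).
by rewrite -[RHS]BH conjE.
Qed.

Lemma herm_of_hermitian (R : realType) (N : nat) (X : 'M[R]_N) : Defs.hermitian (herm_of X).
Proof.
apply/hermitian_conj => i j; rewrite !mxE conjE eq_sym.
case: eqP => [->|/eqP ij] /=; first by rewrite oppr0.
case: ltngtP => //= [|/val_inj ji]; first by rewrite opprK.
by rewrite ji eqxx in ij.
Qed.

Lemma herm_ofD (R : realType) (N : nat) (X Y : 'M[R]_N) :
  herm_of (X + Y) = herm_of X + herm_of Y.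
Proof.
apply/matrixP => i j; rewrite !mxE; case: ifP => _; first by rewrite /= -[RHS]/(Complex _ _) addr0.
by case: ifP => _; rewrite -[RHS]/(Complex _ _) // opprD.
Qed.

Lemma herm_ofZ (R : realType) (N : nat) (a : R) (X : 'M[R]_N) :
  herm_of (a *: X) = Complex a 0 *: herm_of X.
Proof.
apply/matrixP => i j; rewrite !mxE; case: ifP => _.
  by rewrite -[RHS]/(Complex _ _) !mul0r subr0 mulr0 addr0.
by case: ifP => _; rewrite -[RHS]/(Complex _ _) !mul0r subr0 addr0 ?mulrN.
Qed.

(** * Entry bounds for density matrices *)

Lemma psd_quad2 (R : realType) (N : nat) (A : 'M[R[i]]_N) (i j : 'I_N) (c : R[i]) :
  hpsd A ->
  0 <= A i i + c * A i j + Num.conj c * A j i + Num.conj c * c * A j j.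
Proof.
move=> [_ /(_ (delta_mx i 0 + c *: delta_mx j 0))]; congr (0 <= _).
have -> : mxadj (delta_mx i 0 + c *: delta_mx j 0) =
    delta_mx 0 i + Num.conj c *: delta_mx 0 j :> 'rV[R[i]]_N.
  apply/matrixP => a b; rewrite !mxE rmorphD rmorphM /=.
  by rewrite !rmorph_nat (andbC (b == i)) (andbC (b == j)).
rewrite !(mulmxDl, mulmxDr, =^~ scalemxAl, =^~ scalemxAr, scalerDr, scalerA).
rewrite -!rowE -!colE !mxE.
ring.
Qed.

Lemma norm_le_ReIm (R : realType) (z : R[i]) (a b : R) :
  `|complex.Re z| <= a -> `|complex.Im z| <= b -> `|z| <= Complex (a + b) 0.
Proof.
case: z => x y /= xa yb.
have -> : Complex x y = Complex x 0 + Complex 0 1 * Complex y 0.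
  exact: (complexE (Complex x y)).
apply: le_trans (ler_normD _ _) _; rewrite normrM !normc_def /= !expr0n /= !addr0.
rewrite add0r expr1n !sqrtr_sqr sqrtr1 mul1r -[_ + _]/(Complex _ _) lecE /= addr0 eqxx /=.
exact: lerD.
Qed.

Lemma ReIm_le_norm (R : realType) (z : R[i]) (a : R) :
  `|z| <= Complex a 0 -> `|complex.Re z| <= a /\ `|complex.Im z| <= a.
Proof.
case: z => x y; rewrite normc_def lecE /= => /andP[_ h].
have a0 : 0 <= a by apply: le_trans h; exact: sqrtr_ge0.
have h2 : x ^+ 2 + y ^+ 2 <= a ^+ 2.
  rewrite -(@ler_sqrt _ _ (a ^+ 2)) ?sqrtr_sqr ?ger0_norm //; exact: exprn_ge0.
have x2 := sqr_ge0 x; have y2 := sqr_ge0 y.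
by split; rewrite -(ler_pXn2r (n := 2)) ?nnegrE // real_normK ?num_real //; lra.
Qed.

(** The diagonal lies in [0, 1] by positivity and the trace. Positivity at e_i + c e_j for c = 1,
    -1, i, -i then bounds the real and imaginary parts by 1 each; the constant 2 is their crude
    sum. *)
Lemma density_entry_le (R : realType) (N : nat) (A : 'M[R[i]]_N) i j :
  density_matrix A -> `|A i j| <= Complex 2 0.
Proof.
move=> [Apsd trA]; have [/hermitian_conj AH _] := Apsd.
have diag k : 0 <= A k k.
  by have := @psd_quad2 R N A k k 0 Apsd; rewrite rmorph0 !mul0r !addr0.
have diag1 k : complex.Re (A k k) <= 1.
  have : A k k <= 1.
    by rewrite -trA /mxtrace (bigD1 k) //= lerDl sumr_ge0.
  by rewrite lecE => /andP[].
have q c := @psd_quad2 R N A i j c Apsd.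
rewrite (_ : 2 = 1 + 1 :> R); last by lra.
suff [h1 h2] : `|complex.Re (A i j)| <= 1 /\ `|complex.Im (A i j)| <= 1.
  exact: norm_le_ReIm.
have := diag1 i; have := diag1 j; have := diag i; have := diag j.
have := q 1; have := q (-1); have := q (Complex 0 1); have := q (Complex 0 (-1)).
rewrite -(AH i j) !conjE.
case: (A i i) => ai bi; case: (A j j) => aj bj; case: (A i j) => x y.
rewrite !lecE /= => /andP[_ h1] /andP[_ h2] /andP[_ h3] /andP[_ h4] _ _ h5 h6.
by rewrite !ler_norml; lra.

Qed.

Lemma entry_prod_le (R : realType) (p : nat) (n : 'I_p -> nat)
    (A : forall m, 'M[R[i]]_(n m)) r s : (forall m, density_matrix (A m)) ->
  `|entry_prod R p n A r s| <= Complex (2 ^+ p) 0.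
Proof.
move=> Ad; rewrite normr_prod.
have -> : Complex (2 ^+ p) 0 = \prod_(m < p) Complex 2 0 :> R[i].
  rewrite prodr_const card_ord; elim: p {n A Ad} => [|p IH]; first by rewrite !expr0.
  rewrite !exprS -IH; apply/eqP; rewrite eq_complex /= !mul0r mulr0 addr0 subr0.
  by rewrite !eqxx.
apply: ler_prod => m _; rewrite normr_ge0 /= /mxentry.
by case: insubP => [? _ _|_]; [case: insubP => [? _ _|_]|];
  rewrite ?density_entry_le // normr0 lecE /= eqxx /=.
Qed.

(** A basis adapted to the trace: every member is traceless except the one at [(z, z)], which is the
    matrix unit there. Hence the coefficient of a matrix at [(z, z)] is its trace. *)
Definition trace_basis (R : realType) (N : nat) (z : 'I_N) (a : 'I_N * 'I_N) : 'M[R]_N :=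
  delta_mx a.1 a.2 - (a.1 == a.2)%:R *: delta_mx z z + (a == (z, z))%:R *: delta_mx z z.

Lemma trace1_expand (R : realType) (N : nat) (z : 'I_N) (X : 'M[R]_N) : \tr X = 1 ->
  X = \sum_a (if a == (z, z) then 1 else X a.1 a.2) *: trace_basis R N z a.
Proof.
move=> trX; have sumX (c : 'I_N * 'I_N -> R) : \sum_(a | a == (z, z)) c a = c (z, z).
  by rewrite big_pred1_eq.
have -> : \sum_a (if a == (z, z) then 1 else X a.1 a.2) *: trace_basis R N z a =
   \sum_a X a.1 a.2 *: delta_mx a.1 a.2
   - (\sum_(a : 'I_N * 'I_N) X a.1 a.2 * (a.1 == a.2)%:R) *: delta_mx z z
   + (\sum_(a | a == (z, z)) 1) *: delta_mx z z.
  rewrite !scaler_suml -sumrB [X in _ + X]big_mkcond -big_split /=.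
  apply: eq_bigr => a _; rewrite /trace_basis; case: eqVneq => [->|az] /=.
    by rewrite eqxx mulr1 subrr add0r !scale1r subrr add0r.
  by rewrite scale0r !addr0 scalerBr scalerA.
rewrite sumX scale1r.
have -> : \sum_(a : 'I_N * 'I_N) X a.1 a.2 * (a.1 == a.2)%:R = 1.
  transitivity (\sum_i \sum_j X i j * (i == j)%:R); first by rewrite pair_bigA.
  rewrite -[RHS]trX; apply: eq_bigr => i _.
  rewrite (bigD1 i) //= eqxx mulr1 big1 ?addr0 // => j ji.
  by rewrite eq_sym (negbTE ji) mulr0.
rewrite scale1r subrK [LHS]matrix_sum_delta.
by rewrite pair_bigA.
Qed.

Lemma herm_of_sum (R : realType) (N : nat) (I : finType) (c : I -> R) (X : I -> 'M[R]_N) :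
  herm_of (\sum_i c i *: X i) = \sum_i Complex (c i) 0 *: herm_of (X i).
Proof.
have h0 : herm_of (0 : 'M[R]_N) = 0.
  by rewrite -[0 in LHS](scale0r 0) herm_ofZ -[Complex 0 0]/(0 : R[i]) scale0r.
rewrite (big_morph _ (@herm_ofD R N) h0); apply: eq_bigr => i _; exact: herm_ofZ.
Qed.

Lemma hermitian_coords_sum (R : realType) (N : nat) (I : finType) (c : I -> R)
    (X : I -> 'M[R[i]]_N) :
  hermitian_coords R N (\sum_i Complex (c i) 0 *: X i)
  = \sum_i c i *: hermitian_coords R N (X i).
Proof.
have h0 : hermitian_coords R N 0 = 0.
  by apply/matrixP => i j; rewrite !mxE /= !if_same.
have hD : {morph hermitian_coords R N : x y / x + y}.
  move=> x y; apply/matrixP => i j; rewrite !mxE; case: ifP => _; [|case: ifP => _].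
  - by case: (x i i); case: (y i i).
  - by case: (x i j); case: (y i j).
  - by case: (x j i); case: (y j i).
rewrite (big_morph _ hD h0); apply: eq_bigr => i _.
apply/matrixP => a b; rewrite !mxE; case: ifP => _; [|case: ifP => _].
- by case: (X i a a) => x y /=; rewrite mul0r subr0.
- by case: (X i a b) => x y /=; rewrite mul0r subr0.
- by case: (X i b a) => x y /=; rewrite mul0r addr0.
Qed.

Lemma hermitian_coords_le (R : realType) (N : nat) (A : 'M[R[i]]_N) (K : R) i j :
  (forall i j, `|A i j| <= Complex K 0) -> `|hermitian_coords R N A i j| <= K.
Proof.
move=> AK; rewrite mxE.
by case: ifP => _; [|case: ifP => _];
  [have [] := ReIm_le_norm R _ _ (AK i i) | have [] := ReIm_le_norm R _ _ (AK i j)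
  | have [] := ReIm_le_norm R _ _ (AK j i)].
Qed.
Lemma trace_hermitian_coords (R : realType) (N : nat) (A : 'M[R[i]]_N) :
  \tr (hermitian_coords R N A) = complex.Re (\tr A).
Proof.
rewrite /mxtrace (big_morph (@complex.Re R) (id1 := 0) (op1 := +%R)) //.
  by apply: eq_bigr => i _; rewrite mxE eqxx.
by move=> [? ?] [? ?].
Qed.

(** * Few product states: measure zero *)

(** Shorter ensembles are padded with zero weights. The padding repeats the first state, which
    exists because the weights sum to 1. *)
Lemma convex_comb_widen (R : realType) (N : nat) (P : 'M[R[i]]_N -> Prop) (l k : nat) B :
  (l <= k)%N -> convex_comb_of P l B -> convex_comb_of P k B.
Proof.
move=> lk [w [X [w0 w1 PX ->]]].
have l0 : (0 < l)%N.
  rewrite lt0n; apply/eqP => l0; move: w1; rewrite big1 => [/esym/eqP|i].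
    by rewrite oner_eq0.
  by have := ltn_ord i; rewrite {2}l0.
pose e (i : 'I_k) : option 'I_l := insub (val i).
exists (fun i => oapp w 0 (e i)), (fun i => X (odflt (Ordinal l0) (e i))).
have widenE (V : nmodType) (F : 'I_l -> V) :
    \sum_(i < k) oapp F 0 (e i) = \sum_i F i.
  rewrite (eq_bigr (fun i : 'I_l => oapp F 0 (insub (val i)))); last first.
    by move=> i _; rewrite valK.
  rewrite (big_ord_widen k (fun i => oapp F 0 (insub i)) lk) [RHS]big_mkcond /=.
  by apply: eq_bigr => i _; rewrite /e; case: insubP => [? ->|/negbTE ->].
split => [i||i|] //; first by case: (e i) => /=.
  by rewrite widenE.
rewrite -widenE; apply: eq_bigr => i _; case: (e i) => //=.
by rewrite -[Complex 0 0]/(0 : R[i]) scale0r.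
Qed.

Lemma Sigma_k_exact (R : realType) (p : nat) (n : 'I_p -> nat) (k : nat) B :
  @Sigma_k R p n k B -> convex_comb_of (@product_dm R p n) k B.
Proof. by move=> [l [lk]]; exact: convex_comb_widen. Qed.

Lemma card_coordT (N : nat) : (0 < N)%N -> (#|{: coordT N}|.+1 = N * N)%N.
Proof.
case: N => // N _; rewrite -[in RHS](card_ord N.+1) -card_prod -(cardC (pred1 (ord0, ord0))).
rewrite card1 add1n card_sig; congr S; apply: eq_card => -[i j]; rewrite !inE xpair_eqE /=.
by rewrite -!val_eqE; case: i j => [[|i] ?] [[|j] ?] /=; rewrite ?orbT.
Qed.

Lemma mxentry_sum (R : realType) (N : nat) (I : finType) (c : I -> R[i])
    (X : I -> 'M[R[i]]_N) i j :
  mxentry (\sum_a c a *: X a) i j = \sum_a c a * mxentry (X a) i j.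
Proof.
rewrite /mxentry; case: insubP => [i' _ _|_]; [case: insubP => [j' _ _|_]|].
- by rewrite summxE; apply: eq_bigr => a _; rewrite mxE.
- by rewrite big1 // => a _; rewrite mulr0.
- by rewrite big1 // => a _; rewrite mulr0.
Qed.

Lemma Complex_sum (R : realType) (I : finType) (c : I -> R) :
  Complex (\sum_i c i) 0 = \sum_i Complex (c i) 0.
Proof.
by apply: (big_morph (fun x => Complex x 0)) => // x y; rewrite -[RHS]/(Complex _ _) addr0.
Qed.

Lemma ComplexM (R : realType) (x y : R) : Complex (x * y) 0 = Complex x 0 * Complex y 0.
Proof. by rewrite -[RHS]/(Complex _ _) !mul0r !mulr0 subr0 addr0. Qed.

(** The Kronecker product of two Hermitian matrices. The size [N] is left free so that [tdim n] and
    the product [M * q] never have to be identified by a cast. *)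
Definition realigned_basis (R : realType) (M q N : nat) (X : 'M[R]_M) (Y : 'M[R]_q) :
    'M[R[i]]_N :=
  \matrix_(r, s) (mxentry (herm_of X) (r %/ q) (s %/ q) * mxentry (herm_of Y) (r %% q) (s %% q)).

Lemma realigned_basis_sum (R : realType) (M q N : nat) (I J : finType)
    (c : I -> R) (X : I -> 'M[R]_M) (d : J -> R) (Y : J -> 'M[R]_q) :
  realigned_basis R M q N (\sum_i c i *: X i) (\sum_j d j *: Y j) =
  \sum_i \sum_j Complex (c i * d j) 0 *: realigned_basis R M q N (X i) (Y j).
Proof.
apply/matrixP => r s; rewrite mxE !herm_of_sum !mxentry_sum mulr_suml summxE.
apply: eq_bigr => i _; rewrite mulr_sumr summxE; apply: eq_bigr => j _.
by rewrite !mxE ComplexM; ring.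
Qed.

Lemma Sigma_k_null (R : realType) (p : nat) (n : 'I_p.+1 -> nat) (k : nat) :
  (forall m, (0 < n m)%N) -> (0 < k)%N -> (tdim (front p n) <= n ord_max)%N ->
  (k < tdim (front p n) ^ 2)%N -> tau_null (@Sigma_k R p.+1 n k).
Proof.
move=> npos k0 Mq kM; set M := tdim (front p n) in Mq kM *; set q := n ord_max in Mq *.
have q0 : (0 < q)%N by exact: npos.
have M0 : (0 < M)%N by apply: prodn_gt0 => m; exact: npos.
pose z := Ordinal M0; pose z' := Ordinal q0.
have NE : tdim n = (M * q)%N by rewrite tdim_front.
have N0 : (0 < tdim n)%N by rewrite NE muln_gt0 M0.
have cT := card_coordT _ N0.
apply: null_set_finitely_null.
  (* From 0 < k < M^2 it follows that M > 1, so the hyperplane has at least one coordinate. *)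
  have M1 : (1 < M)%N.
    rewrite ltnNge; apply/negP => M1; move: (leq_ltn_trans k0 kM).
    by rewrite (_ : M = 1%N) //; apply/eqP; rewrite eqn_leq M1.
  rewrite -ltnS cT NE (leq_trans M1) // -mulnA leq_pmulr // !muln_gt0 q0 M0 //.
(* The linear map back from realigned coordinates: [phi t a b] is the coordinate [t] of the product
   of the basis elements [a] and [b]. *)
pose phi (t : coordT (tdim n)) (a : 'I_M * 'I_M) (b : 'I_q * 'I_q) : R :=
  hermitian_coords R _ (realigned_basis R M q (tdim n) (trace_basis R M z a) (trace_basis R q z' b))
    (val t).1 (val t).2.
apply: finitely_null_sub
  (@finitely_null_low_rank R _ _ _ (z, z) (z', z') k (2 ^+ p.+1) phi _ _ _).
- move=> y /= /Sigma_k_exact[w [X [w0 w1 PX yE]]].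
  have [A /all_and2[Ad XE]] := fin_all_exists PX.
  pose U i : 'M[R[i]]_M := \matrix_(r, s) entry_prod R p (front p n) (front_mx R p n (A i)) r s.
  have AH i m : Defs.hermitian (A i m) by case: (Ad i m) => -[].
  have UH i : Defs.hermitian (U i).
    by apply/hermitian_conj => r s; rewrite !mxE entry_prod_conj // => m; exact: AH.
  have Utr i : \tr (U i) = 1.
    rewrite -mxentry_trace; under eq_big_nat.
      move=> r /= rM; rewrite (_ : mxentry _ _ _ = entry_prod R p (front p n) (front_mx R p n (A i)) r r); last first.
        by rewrite -[r]/(val (Ordinal rM)) mxentryE mxE.
      over.
    rewrite entry_prod_trace big1 // => m _; rewrite mxentry_trace.
    by case: (Ad i (widen_ord (leqnSn p) m)).
  have Vtr i : \tr (A i ord_max) = 1 by case: (Ad i ord_max).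
  (* The coefficients in the trace basis; the value 1 at [(z, z)] is the trace of the front
     factor. *)
  pose u i (a : 'I_M * 'I_M) : R :=
    if a == (z, z) then 1 else hermitian_coords R _ (U i) a.1 a.2.
  pose v i (b : 'I_q * 'I_q) : R :=
    if b == (z', z') then 1 else hermitian_coords R _ (A i ord_max) b.1 b.2.
  have XW i : X i = realigned_basis R M q (tdim n) (\sum_a u i a *: trace_basis R M z a)
      (\sum_b v i b *: trace_basis R q z' b).
    rewrite /u /v -!trace1_expand ?trace_hermitian_coords ?Utr ?Vtr //.
    apply/matrixP => r s; rewrite XE prod_mxE.
 rewrite entry_prodS [RHS]mxE !hermitian_coordsK; [|exact: AH|exact: UH].
    have dl (c : 'I_(tdim n)) : (c %/ q < M)%N by rewrite ltn_divLR // -NE.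
    congr (_ * _) => //.
    by rewrite -[(r %/ _)%N]/(val (Ordinal (dl r))) -[(s %/ _)%N]/(val (Ordinal (dl s))) mxentryE mxE.
  rewrite /=; exists w; exists u; exists v; split => //.
  (* The front part is a product of p factors with entries at most 2, the last factor has entries at
     most 2, and both bounds are below 2^(p+1). *)
  - have one2 m : 1 <= 2 ^+ m :> R by rewrite exprn_ege1 // ler1n.
    move=> i a b; rewrite /u /v; split; case: ifP => _; rewrite ?normr1 ?one2 //.
      apply: hermitian_coords_le => r s; rewrite mxE.
      apply: le_trans (entry_prod_le _ _ _ _ _ _ (fun m => Ad i _)) _.
      by rewrite lecE /= eqxx ler_eXn2l ?ltr1n // leqnSn.
    apply: hermitian_coords_le => r s; apply: le_trans (density_entry_le _ _ _ _ _ (Ad i _)) _.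
    by rewrite lecE /= eqxx /= exprS ler_peMr.
  - apply/funext => t.
    have -> : y t = @tau_coord R _ y (val t).1 (val t).2.
      by rewrite mxE -surjective_pairing valK.
    rewrite -(herm_ofK R _ (tau_coord y)) yE hermitian_coords_sum summxE.
    rewrite (eq_bigr (fun i => \sum_a \sum_b w i * u i a * v i b * phi t a b)).
      rewrite exchange_big; apply: eq_bigr => a _.
      by rewrite exchange_big; apply: eq_bigr => b _; rewrite mulr_suml.
    move=> i _; rewrite mxE XW realigned_basis_sum pair_bigA hermitian_coords_sum summxE mulr_sumr pair_bigA.
    by apply: eq_bigr => -[a b] _; rewrite mxE /phi; ring.
- by rewrite cT NE !card_prod !card_ord mulnACA.
- by rewrite !card_prod !card_ord leq_mul.
- by rewrite card_prod card_ord mulnn.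
Qed.

(** * Compactness and connectedness *)

Lemma continuous_mx (T : topologicalType) (R : realType) (m n : nat) (G : T -> 'M[R]_(m, n)) :
  (forall i j, continuous (fun x => G x i j)) -> continuous G.
Proof.
move=> Gc x A [B nB BA].
have : \forall y \near x, forall i j, B i j (G y i j).
  by apply: filter_forall => i; apply: filter_forall => j; exact: (Gc i j x).
by apply: filterS => y By; apply: BA.
Qed.

(** Continuity by real and imaginary parts, since the topology in use is that of the real
    coordinates. *)
Definition complex_continuous (T : topologicalType) (R : realType) (f : T -> R[i]) : Prop :=
  continuous (fun x => complex.Re (f x)) /\ continuous (fun x => complex.Im (f x)).

Lemma complex_continuous_cst (T : topologicalType) (R : realType) (c : R[i]) :
  complex_continuous T R (fun=> c).
Proof. by split => x; exact: cvg_cst. Qed.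

Lemma complex_continuousD (T : topologicalType) (R : realType) (f g : T -> R[i]) :
  complex_continuous T R f -> complex_continuous T R g ->
  complex_continuous T R (fun x => f x + g x).
Proof.
move=> [f1 f2] [g1 g2]; split.
  rewrite (_ : (fun _ => _) = (fun x => complex.Re (f x) + complex.Re (g x))).
    by move=> x; apply: cvgD; [exact: f1|exact: g1].
  by apply/funext => x; case: (f x); case: (g x).
rewrite (_ : (fun _ => _) = (fun x => complex.Im (f x) + complex.Im (g x))).
  by move=> x; apply: cvgD; [exact: f2|exact: g2].
by apply/funext => x; case: (f x); case: (g x).
Qed.

Lemma complex_continuousM (T : topologicalType) (R : realType) (f g : T -> R[i]) :
  complex_continuous T R f -> complex_continuous T R g ->
  complex_continuous T R (fun x => f x * g x).
Proof.
move=> [f1 f2] [g1 g2]; split.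
  rewrite (_ : (fun _ => _) = (fun x => complex.Re (f x) * complex.Re (g x)
      - complex.Im (f x) * complex.Im (g x))).
    by move=> x; apply: cvgB; apply: cvgM; [exact: f1|exact: g1|exact: f2|exact: g2].
  by apply/funext => x; case: (f x); case: (g x).
rewrite (_ : (fun _ => _) = (fun x => complex.Re (f x) * complex.Im (g x)
    + complex.Im (f x) * complex.Re (g x))).
  by move=> x; apply: cvgD; apply: cvgM; [exact: f1|exact: g2|exact: f2|exact: g1].
by apply/funext => x; case: (f x); case: (g x).
Qed.

Lemma complex_continuous_sum (T : topologicalType) (R : realType) (I : Type) (r : seq I)
    (f : I -> T -> R[i]) :
  (forall i, complex_continuous T R (f i)) ->
  complex_continuous T R (fun x => \sum_(i <- r) f i x).
Proof.
move=> fc; elim: r => [|i r IH].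
  under eq_fun do rewrite big_nil; exact: complex_continuous_cst.
under eq_fun do rewrite big_cons; exact: complex_continuousD.
Qed.

Lemma complex_continuous_prod (T : topologicalType) (R : realType) (I : Type) (r : seq I)
    (f : I -> T -> R[i]) :
  (forall i, complex_continuous T R (f i)) ->
  complex_continuous T R (fun x => \prod_(i <- r) f i x).
Proof.
move=> fc; elim: r => [|i r IH].
  under eq_fun do rewrite big_nil; exact: complex_continuous_cst.
under eq_fun do rewrite big_cons; exact: complex_continuousM.
Qed.

Lemma complex_continuous_closed_ge0 (T : topologicalType) (R : realType) (f : T -> R[i]) :
  complex_continuous T R f -> closed [set x | 0 <= f x].
Proof.
move=> [f1 f2].
have -> : [set x | 0 <= f x] =
    (fun x => complex.Im (f x)) @^-1` [set 0] `&` (fun x => complex.Re (f x)) @^-1` [set y | 0 <= y].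
  by apply/seteqP; split => x /=; rewrite lecE /=; [case/andP => /eqP|case=> -> ->; rewrite eqxx].
apply: closedI; apply: preimage_closed.
- by move=> x _; exact: f2.
- exact: closed_eq.
- by move=> x _; exact: f1.
- exact: closed_ge.
Qed.

Lemma complex_continuous_closed_eq (T : topologicalType) (R : realType) (f : T -> R[i]) c :
  complex_continuous T R f -> closed [set x | f x = c].
Proof.
move=> [f1 f2].
have -> : [set x | f x = c] =
    (fun x => complex.Im (f x)) @^-1` [set complex.Im c] `&`
    (fun x => complex.Re (f x)) @^-1` [set complex.Re c].
  apply/seteqP; split => x /= [] => [->//|]; by case: (f x) (c) => ? ? [? ?] /= -> ->.
apply: closedI; apply: preimage_closed; try exact: closed_eq.
  by move=> x _; exact: f2.
by move=> x _; exact: f1.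
Qed.

Lemma herm_of_continuous (T : topologicalType) (R : realType) (N : nat) (X : T -> 'M[R]_N) i j :
  (forall i j, continuous (fun x => X x i j)) ->
  complex_continuous T R (fun x => herm_of (X x) i j).
Proof.
move=> Xc; under eq_fun do rewrite mxE.
case: (i == j); first by split=> x; [exact: Xc|exact: cvg_cst].
case: (i < j)%N; split=> x; try exact: Xc.
by apply: cvgN; exact: Xc.
Qed.

(** Hermitian symmetry is built into [herm_of]; what remains is one closed condition for each vector
    [v] and the trace equation. *)
Lemma density_closed (T : topologicalType) (R : realType) (N : nat) (X : T -> 'M[R]_N) :
  (forall i j, continuous (fun x => X x i j)) ->
  closed [set x | density_matrix (herm_of (X x))].
Proof.
move=> Xc.
have -> : [set x | density_matrix (herm_of (X x))] =
   (\bigcap_(v in [set: 'cV[R[i]]_N]) [set x | 0 <= (mxadj v *m herm_of (X x) *m v) 0 0])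
   `&` [set x | \tr (herm_of (X x)) = 1].
  apply/seteqP; split => x /=; first by move=> [[_ psd] tr1]; split=> // v _; exact: psd.
  move=> [psd tr1]; split; last exact: tr1.
  by split=> [|v]; [exact: herm_of_hermitian|exact: (psd v I)].
apply: closedI; last first.
  apply: complex_continuous_closed_eq; apply: complex_continuous_sum => i.
  exact: herm_of_continuous.
apply: closed_bigI => v _; apply: complex_continuous_closed_ge0.
under eq_fun do rewrite mxE; apply: complex_continuous_sum => j.
apply: complex_continuousM; last exact: complex_continuous_cst.
under eq_fun do rewrite mxE; apply: complex_continuous_sum => i.
apply: complex_continuousM; first exact: complex_continuous_cst.
exact: herm_of_continuous.
Qed.

(** One index for each weight and for each real coordinate of each factor. Flattening an ensemble
    into a single row vector lets the compactness of closed bounded sets apply. *)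
Definition ensemble_index (p : nat) (n : 'I_p -> nat) (k : nat) : finType :=
  ('I_k + 'I_k * {m : 'I_p & 'I_(n m) * 'I_(n m)})%type.

Definition weight_of (R : realType) (p : nat) (n : 'I_p -> nat) (k : nat)
    (x : 'rV[R]_#|ensemble_index p n k|) (i : 'I_k) : R :=
  x 0 (enum_rank (inl i : ensemble_index p n k)).

Definition factor_of (R : realType) (p : nat) (n : 'I_p -> nat) (k : nat)
    (x : 'rV[R]_#|ensemble_index p n k|) (i : 'I_k) (m : 'I_p) : 'M[R]_(n m) :=
  \matrix_(a, b) x 0 (enum_rank (inr (i,
    Tagged (fun m => 'I_(n m) * 'I_(n m))%type (a, b)) : ensemble_index p n k)).

Definition ensembles (R : realType) (p : nat) (n : 'I_p -> nat) (k : nat) :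
    set 'rV[R]_#|ensemble_index p n k| :=
  [set x | [/\ forall i, 0 <= weight_of R p n k x i, \sum_i weight_of R p n k x i = 1
    & forall i m, density_matrix (herm_of (factor_of R p n k x i m))]].

Definition mixture (R : realType) (p : nat) (n : 'I_p -> nat) (k : nat)
    (x : 'rV[R]_#|ensemble_index p n k|) : 'M[R[i]]_(tdim n) :=
  \sum_i Complex (weight_of R p n k x i) 0 *:
    prod_mx (fun m => herm_of (factor_of R p n k x i m)).

Lemma hermitian_sum_prod_mx (R : realType) (p : nat) (n : 'I_p -> nat) (k : nat)
    (w : 'I_k -> R) (A : 'I_k -> forall m, 'M[R[i]]_(n m)) :
  (forall i m, Defs.hermitian (A i m)) ->
  Defs.hermitian (\sum_i Complex (w i) 0 *: prod_mx (A i)).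
Proof.
move=> AH; apply/hermitian_conj => r s; rewrite !summxE rmorph_sum.
apply: eq_bigr => i _; rewrite !mxE rmorphM /=; congr (_ * _).
  by rewrite conjE /= oppr0.
exact: (entry_prod_conj R p n (A i)).
Qed.

(** Padding to exactly [k] terms lets a single parameter space produce all mixtures of at most [k]
    terms. *)
Lemma hcoords_Sigma_k (R : realType) (p : nat) (n : 'I_p -> nat) (k : nat) :
  hcoords (@Sigma_k R p n k) =
  (fun x => hermitian_coords R _ (mixture R p n k x)) @` ensembles R p n k.
Proof.
apply/seteqP; split => [X /Sigma_k_exact[w [Y [w0 w1 PY XE]]]|X [x [x0 x1 xd] <-]].
  have [A /all_and2[Ad YE]] := fin_all_exists PY.
  pose x : 'rV[R]_#|ensemble_index p n k| := \row_j
    match enum_val j with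
    | inl i => w i
    | inr (i, t) => hermitian_coords R _ (A i (tag t)) (tagged t).1 (tagged t).2
    end.
  have wE i : weight_of R p n k x i = w i by rewrite /weight_of mxE enum_rankK.
  have AE i m : herm_of (factor_of R p n k x i m) = A i m.
    rewrite -[RHS]hermitian_coordsK; last by case: (Ad i m) => -[].
    by congr herm_of; apply/matrixP => a b; rewrite mxE mxE enum_rankK.
  exists x.
    split=> [i||i m]; rewrite ?wE ?AE //.
    by rewrite -w1; apply: eq_bigr => i _.
  rewrite -[RHS](herm_ofK R) XE; congr hermitian_coords; apply: eq_bigr => i _.
  rewrite wE YE; congr (_ *: _); apply/matrixP => r s; rewrite !mxE.
  by apply: eq_bigr => m _; rewrite AE.
exists k; split => //.
exists (weight_of R p n k x), (fun i => prod_mx (fun m => herm_of (factor_of R p n k x i m))).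
split=> //; first by move=> i; exists (fun m => herm_of (factor_of R p n k x i m)).
by rewrite hermitian_coordsK //; apply: hermitian_sum_prod_mx => i m; exact: herm_of_hermitian.
Qed.

Lemma hermitian_coords_continuous (T : topologicalType) (R : realType) (N : nat)
    (B : T -> 'M[R[i]]_N) :
  (forall i j, complex_continuous T R (fun x => B x i j)) ->
  continuous (fun x => hermitian_coords R N (B x)).
Proof.
move=> Bc; apply: continuous_mx => i j; under eq_fun do rewrite mxE.
by case: (i == j); [|case: (i < j)%N]; [case: (Bc i i)|case: (Bc i j)|case: (Bc j i)].
Qed.

Lemma mixture_continuous (R : realType) (p : nat) (n : 'I_p -> nat) (k : nat) :
  continuous (fun x => hermitian_coords R _ (mixture R p n k x)).
Proof.
apply: hermitian_coords_continuous => r s; under eq_fun do rewrite summxE.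
apply: complex_continuous_sum => i; under eq_fun do rewrite mxE.
apply: complex_continuousM.
  split; [move=> x; exact: coord_continuous|].
  by move=> x; exact: cst_continuous.
under eq_fun do rewrite mxE.
apply: complex_continuous_prod => m; rewrite /mxentry.
case: insubP => [a _ _|_]; last exact: complex_continuous_cst.
case: insubP => [b _ _|_]; last exact: complex_continuous_cst.
apply: herm_of_continuous => i' j'; under eq_fun do rewrite mxE.
exact: coord_continuous.
Qed.

Lemma ensembles_closed (R : realType) (p : nat) (n : 'I_p -> nat) (k : nat) :
  closed (ensembles R p n k).
Proof.
have wc i : continuous (fun x => weight_of R p n k x i) by exact: coord_continuous.
have -> : ensembles R p n k =
    (\bigcap_(i in [set: 'I_k]) [set x | 0 <= Complex (weight_of R p n k x i) 0]) `&`
    [set x | \sum_i Complex (weight_of R p n k x i) 0 = 1] `&`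
    (\bigcap_(i in [set: 'I_k]) \bigcap_(m in [set: 'I_p])
      [set x | density_matrix (herm_of (factor_of R p n k x i m))]).
  apply/seteqP; split => x /=.
    move=> [x0 x1 xd]; split; last by move=> i _ m _; exact: xd.
    split; first by move=> i _ /=; rewrite lecE /= eqxx x0.
    by rewrite -Complex_sum x1.
  move=> [[x0 x1] xd]; split => [i||i m]; last exact: (xd i I m I).
    by have := x0 i I; rewrite /= lecE => /andP[].
  by move: x1; rewrite -Complex_sum => -[].
apply: closedI; [apply: closedI|].
- apply: closed_bigI => i _; apply: complex_continuous_closed_ge0.
  by split=> x; [exact: wc|exact: cst_continuous].
- apply: complex_continuous_closed_eq; apply: complex_continuous_sum => i.
  by split=> x; [exact: wc|exact: cst_continuous].
- apply: closed_bigI => i _; apply: closed_bigI => m _; apply: density_closed => a b.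
  under eq_fun do rewrite mxE; exact: coord_continuous.
Qed.

Lemma ensembles_compact (R : realType) (p : nat) (n : 'I_p -> nat) (k : nat) :
  compact (ensembles R p n k).
Proof.
apply: bounded_closed_compact; last exact: ensembles_closed.
(* Weights are at most 1, and the coordinates of the factors at most 2 by the entry bound. *)
exists 2; split => [|K K2 x [x0 x1 xd]]; first exact: num_real.
rewrite /= [X in X <= _]/Num.Def.normr /= mx_normrE; apply/bigmax_leP; split => [|[i j] _ /=].
  by apply: ltW; apply: lt_trans K2.
apply: le_trans (ltW K2); rewrite (ord1 i) -(enum_valK j).
case: (enum_val j) => [l|[l [m [a b]]]].
  rewrite -/(weight_of R p n k x l) ger0_norm //.
  apply: (@le_trans _ _ 1); last by lra.
  by rewrite -x1 (bigD1 l) //= lerDl sumr_ge0.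
have -> : x 0 (enum_rank (inr (l, existT _ m (a, b)) : ensemble_index p n k)) =
   factor_of R p n k x l m a b by rewrite mxE.
rewrite -(herm_ofK R _ (factor_of R p n k x l m)); apply: hermitian_coords_le => r s.
exact: density_entry_le.
Qed.

Lemma density_convex (R : realType) (N : nat) (A B : 'M[R[i]]_N) (s t : R) :
  0 <= s -> 0 <= t -> s + t = 1 -> density_matrix A -> density_matrix B ->
  density_matrix (Complex s 0 *: A + Complex t 0 *: B).
Proof.
move=> s0 t0 st [[/hermitian_conj AH Ap] At] [[/hermitian_conj BH Bp] Bt].
split; first split.
- apply/hermitian_conj => i j; rewrite !mxE rmorphD !rmorphM /= AH BH.
  by rewrite !conjE /= oppr0.
- move=> v; rewrite mulmxDr mulmxDl -!scalemxAr -!scalemxAl mxE [X in X + _]mxE [X in _ + X]mxE.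
  by rewrite addr_ge0 // mulr_ge0 // ?lecE /= ?eqxx.
rewrite mxtraceD !mxtraceZ At Bt !mulr1.
by rewrite -[LHS]/(Complex _ _) st addr0.
Qed.

(** The convexity is that of the parameters, each weight and factor moving on its own segment; the
    set of mixtures itself need not be convex. *)
Lemma ensembles_convex (R : realType) (p : nat) (n : 'I_p -> nat) (k : nat) x y (t : R) :
  0 <= t <= 1 -> ensembles R p n k x -> ensembles R p n k y ->
  ensembles R p n k ((1 - t) *: x + t *: y).
Proof.
move=> /andP[t0 t1] [x0 x1 xd] [y0 y1 yd].
have t1' : 0 <= 1 - t by lra.
have wE i : weight_of R p n k ((1 - t) *: x + t *: y) i =
    (1 - t) * weight_of R p n k x i + t * weight_of R p n k y i by rewrite /weight_of !mxE.
split => [i||i m]; first by rewrite wE addr_ge0 // mulr_ge0.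
  by under eq_bigr do rewrite wE; rewrite big_split /= -!mulr_sumr x1 y1; lra.
have -> : factor_of R p n k ((1 - t) *: x + t *: y) i m =
    (1 - t) *: factor_of R p n k x i m + t *: factor_of R p n k y i m.
  by apply/matrixP => a b; rewrite !mxE.
by rewrite herm_ofD !herm_ofZ; apply: density_convex => //; lra.
Qed.

(** The images of the segments issuing from one ensemble [x0] are connected, share the mixture of
    [x0], and cover the whole set. *)
Lemma hcoords_Sigma_k_connected (R : realType) (p : nat) (n : 'I_p -> nat) (k : nat) :
  connected (hcoords (@Sigma_k R p n k)).
Proof.
rewrite hcoords_Sigma_k.
have [->|/set0P[x0 Kx0]] := eqVneq (ensembles R p n k) set0.
  by rewrite image_set0; exact: connected0.
pose path (x : 'rV[R]_#|ensemble_index p n k|) (t : R) := hermitian_coords R _ (mixture R p n k ((1 - t) *: x0 + t *: x)).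
have -> : (fun x => hermitian_coords R _ (mixture R p n k x)) @` ensembles R p n k =
    \bigcup_(x in ensembles R p n k) (path x @` `[0, 1]).
  apply/seteqP; split => [_ [x Kx <-]|_ [x Kx [t t01 <-]]].
    exists x => //; exists 1; first by rewrite /= in_itv /= ler01 lexx.
    by rewrite /path subrr scale0r add0r scale1r.
  exists ((1 - t) *: x0 + t *: x) => //; apply: ensembles_convex => //.
apply: bigcup_connected.
  exists (path x0 0) => x Kx; exists 0; first by rewrite /= in_itv /= ler01 lexx.
  by rewrite /path subr0 !scale0r.
move=> x Kx; apply: connected_continuous_connected; first exact: segment_connected.
have pc : continuous (fun t : R => (1 - t) *: x0 + t *: x).
  move=> t; apply: cvgD; last by apply: cvgZl; exact: cvg_id.
  by apply: cvgZl; apply: cvgB; [exact: cvg_cst|exact: cvg_id].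
apply: continuous_subspaceT => t.
exact: (continuous_comp (pc t) (mixture_continuous R p n k _)).
Qed.

Lemma hcoords_Sigma_k_compact (R : realType) (p : nat) (n : 'I_p -> nat) (k : nat) :
  compact (hcoords (@Sigma_k R p n k)).
Proof.
rewrite hcoords_Sigma_k; apply: continuous_compact; last exact: ensembles_compact.
by apply: continuous_subspaceT; exact: mixture_continuous.
Qed.

(** * Many product states: interior points *)

(** One vector per ordered pair: e_a on the diagonal, e_a + e_b for a < b, e_a + i e_b for a > b.
    The order of the pair selects the phase, so that there are d^2 states in all, as many as the
    dimension of the matrix algebra. *)
Definition state_vec (R : realType) (d : nat) (a b : 'I_d) (i : 'I_d) : R[i] :=
  (i == a)%:R + (if a == b then 0 else if (a < b)%N then 1 else Complex 0 1) * (i == b)%:R.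

Definition pure_state (R : realType) (d : nat) (a b : 'I_d) : 'M[R[i]]_d :=
  \matrix_(i, j) ((if a == b then 1 else 2^-1) *
    (state_vec R d a b i * Num.conj (state_vec R d a b j))).

Lemma pure_state_density (R : realType) (d : nat) (a b : 'I_d) :
  density_matrix (pure_state R d a b).
Proof.
pose c : R[i] := if a == b then 1 else 2^-1.
have c0 : 0 <= c by rewrite /c; case: ifP => _; rewrite ?invr_ge0.
split; first split.
- apply/hermitian_conj => i j; rewrite !mxE -/c rmorphM /= (geC0_conj c0) rmorphM /= conjCK.
  by rewrite [X in _ * X]mulrC.
- move=> v; rewrite mxE.
  (* The state has rank one, so its quadratic form is a nonnegative multiple of the squared modulus
     of an inner product. *)
  pose z := \sum_i Num.conj (state_vec R d a b i) * v i 0.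
  have -> : \sum_j (mxadj v *m pure_state R d a b) 0 j * v j 0 = c * (Num.conj z * z).
    have zE : Num.conj z = \sum_i state_vec R d a b i * Num.conj (v i 0).
      by rewrite rmorph_sum; apply: eq_bigr => i _; rewrite rmorphM /= conjCK.
    rewrite /z !mulr_sumr; apply: eq_bigr => j _.
    rewrite mxE zE !mulr_suml mulr_sumr; apply: eq_bigr => i _.
    by rewrite !mxE -/c; ring.
  by rewrite mulr_ge0 // mulrC mul_conjC_ge0.
rewrite /mxtrace; under eq_bigr do rewrite mxE -/c.
rewrite -mulr_sumr /c /state_vec.
have [ab|ab] := eqVneq a b.
  rewrite (bigD1 a) //= big1 ?addr0 => [|i ia]; rewrite ?eqxx ?(negbTE ia) mul0r addr0 ?mul0r //.
  by rewrite rmorph_nat -natrM mul1r.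
rewrite (bigD1 a) //= (bigD1 b) ?[b == a]eq_sym //= big1 => [|i /andP[ia ib]]; last first.
  by rewrite (negbTE ia) (negbTE ib) mulr0 addr0 mul0r.
rewrite !eqxx ?(eq_sym b a) (negbTE ab) !(mulr0, mulr1, addr0, add0r) mul1r.
suff -> : (if (a < b)%N then 1 else Complex 0 1) * Num.conj (if (a < b)%N then 1 else Complex 0 1) = 1 :> R[i].
  by rewrite rmorph_nat -[_ + 1]/(2 : R[i]) mulVf // pnatr_eq0.
case: ifP => _; first by rewrite rmorph1 mulr1.
by rewrite conjE /=; apply/eqP; rewrite eq_complex /= !mul0r !mulr0 mul1r opprK add0r addr0 !eqxx.
Qed.

Definition in_pure_span (R : realType) (d : nat) (X : 'M[R[i]]_d) : Prop :=
  exists c : 'I_d * 'I_d -> R[i], X = \sum_x c x *: pure_state R d x.1 x.2.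

Lemma in_pure_spanD (R : realType) (d : nat) (X Y : 'M[R[i]]_d) :
  in_pure_span R d X -> in_pure_span R d Y -> in_pure_span R d (X + Y).
Proof.
move=> [c ->] [c' ->]; exists (fun x => c x + c' x); rewrite -big_split.
by apply: eq_bigr => x _; rewrite scalerDl.
Qed.

Lemma in_pure_spanZ (R : realType) (d : nat) (e : R[i]) (X : 'M[R[i]]_d) :
  in_pure_span R d X -> in_pure_span R d (e *: X).
Proof.
move=> [c ->]; exists (fun x => e * c x); rewrite scaler_sumr.
by apply: eq_bigr => x _; rewrite scalerA.
Qed.

Lemma in_pure_span_state (R : realType) (d : nat) (a b : 'I_d) :
  in_pure_span R d (pure_state R d a b).
Proof.
exists (fun x => (x == (a, b))%:R); rewrite (bigD1 (a, b)) //= eqxx scale1r big1 ?addr0 //.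
by move=> x /negbTE ->; rewrite scale0r.
Qed.

(* polarisation: off-diagonal matrix units from the states (e_a + e_b)/sqrt 2 and
   (e_b + i e_a)/sqrt 2 *)
Lemma delta_in_pure_span (R : realType) (d : nat) (a b : 'I_d) :
  in_pure_span R d (delta_mx a b).
Proof.
pose S x y := in_pure_span_state R d x y.
have diag x : delta_mx x x = pure_state R d x x.
  apply/matrixP => i j; rewrite !mxE /state_vec eqxx !mul0r !addr0 mul1r rmorph_nat.
  by rewrite -natrM mulnb.
have off (x y : 'I_d) : (x < y)%N -> pure_state R d x y =
    2^-1 *: (delta_mx x x + delta_mx y y + delta_mx x y + delta_mx y x).
  move=> xy; have nxy : x == y = false by apply/negbTE; rewrite -val_eqE neq_ltn xy.
  apply/matrixP => i j; rewrite !mxE /state_vec nxy xy !mul1r rmorphD !rmorph_nat.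
  by rewrite -!mulnb !natrM; ring.
have off' (x y : 'I_d) : (x < y)%N -> pure_state R d y x =
    2^-1 *: (delta_mx x x + delta_mx y y + Complex 0 1 *: delta_mx x y - Complex 0 1 *: delta_mx y x).
  move=> xy; have nxy : y == x = false by apply/negbTE; rewrite -val_eqE neq_ltn xy orbT.
  apply/matrixP => i j; rewrite !mxE /state_vec nxy ltnNge (ltnW xy) /= rmorphD rmorphM /= !rmorph_nat.
  have -> : Num.conj (Complex 0 1) = - Complex 0 1 :> R[i].
    by rewrite conjE /=; apply/eqP; rewrite eq_complex /= oppr0 !eqxx.
  have i2 : Complex 0 1 * Complex 0 1 = -1 :> R[i] by rewrite -expr2 sqr_i.
  rewrite -!mulnb !natrM.
  set ix := (i == x)%:R; set iy := (i == y)%:R; set jx := (j == x)%:R; set jy := (j == y)%:R.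
  have -> : (iy + Complex 0 1 * ix) * (jy + - Complex 0 1 * jx) =
     iy * jy + Complex 0 1 * (ix * jy) - Complex 0 1 * (iy * jx) - (Complex 0 1 * Complex 0 1) * (ix * jx) by ring.
  by rewrite i2; ring.
have i2 : Complex 0 1 * Complex 0 1 = -1 :> R[i] by rewrite -expr2 sqr_i.
have [ab|ba|/val_inj ->] := ltngtP a b; last by rewrite diag; exact: S.
(* The two mixed states combine to the matrix unit plus a diagonal part, which the last summand
   cancels. *)
- have -> : delta_mx a b = pure_state R d a b + (- Complex 0 1) *: pure_state R d b a
      + (2^-1 * (Complex 0 1 - 1)) *: (pure_state R d a a + pure_state R d b b).
    rewrite -!diag off // off' //; apply/matrixP => i j; rewrite !mxE.
    set A := ((i == a) && (j == a))%:R; set B := ((i == b) && (j == b))%:R.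
    set E := ((i == a) && (j == b))%:R; set F := ((i == b) && (j == a))%:R.
    rewrite [RHS](_ : _ = 2^-1 * (E + F) - (Complex 0 1 * Complex 0 1) * 2^-1 * (E - F)); last by ring.
    by rewrite i2; field.
  by apply: in_pure_spanD; [apply: in_pure_spanD|];
    do ?apply: in_pure_spanZ; try (apply: in_pure_spanD); exact: S.
- have -> : delta_mx a b = pure_state R d b a + Complex 0 1 *: pure_state R d a b
      + (2^-1 * (- Complex 0 1 - 1)) *: (pure_state R d a a + pure_state R d b b).
    rewrite -!diag off // off' //; apply/matrixP => i j; rewrite !mxE.
    set A := ((i == a) && (j == a))%:R; set B := ((i == b) && (j == b))%:R.
    set E := ((i == a) && (j == b))%:R; set F := ((i == b) && (j == a))%:R.
    rewrite [RHS](_ : _ = 2^-1 * (E + F) + (Complex 0 1 * Complex 0 1) * 2^-1 * (F - E)); last by ring.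
    by rewrite i2; field.
  by apply: in_pure_spanD; [apply: in_pure_spanD|];
    do ?apply: in_pure_spanZ; try (apply: in_pure_spanD); exact: S.
Qed.

(* A pair of naturals labels a pure state in every dimension exceeding both, so
   that a choice of one pure state per factor is not a dependent function. *)
Definition labelled_state (R : realType) (d : nat) (l : nat * nat) : 'M[R[i]]_d :=
  match insub l.1, insub l.2 with
  | Some a, Some b => pure_state R d a b
  | _, _ => 0
  end.

Lemma labelled_stateE (R : realType) (d : nat) (a b : 'I_d) :
  labelled_state R d (val a, val b) = pure_state R d a b.
Proof. by rewrite /labelled_state !valK. Qed.

Lemma labelled_state_density (R : realType) (d : nat) (l : nat * nat) :
  (l.1 < d)%N -> (l.2 < d)%N -> density_matrix (labelled_state R d l).
Proof.
case: l => a b /= ad bd.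
rewrite -[a]/(val (Ordinal ad)) -[b]/(val (Ordinal bd)) labelled_stateE.
exact: pure_state_density.
Qed.

(** Products of spanning families span the tensor product: a matrix unit of the whole is the product
    of a matrix unit of the front part and one of the last factor, and the coefficients multiply. *)
Lemma labelled_products_span (R : realType) (p : nat) (n : 'I_p -> nat) :
  exists (I : finType) (lab : I -> nat -> nat * nat),
  [/\ #|I| = (tdim n ^ 2)%N,
      forall x (m : 'I_p), ((lab x m).1 < n m)%N /\ ((lab x m).2 < n m)%N
    & forall r s, (r < tdim n)%N -> (s < tdim n)%N -> exists c : I -> R[i],
        forall r' s', (r' < tdim n)%N -> (s' < tdim n)%N ->
          \sum_x c x * entry_prod R p n (fun m => labelled_state R (n m) (lab x m)) r' s'
          = ((r' == r) && (s' == s))%:R].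
Proof.
elim: p n => [|p IH] n.
  exists unit, (fun _ _ => (0, 0)%N); split => [|_ []|r s] //.
    by rewrite card_unit /tdim big_ord0.
  rewrite /tdim big_ord0 !ltnS !leqn0 => /eqP -> /eqP ->; exists (fun=> 1) => r' s'.
  rewrite !ltnS !leqn0 => /eqP -> /eqP ->.
  rewrite (bigD1 tt) //= big1 ?addr0; last by case.
  by rewrite mul1r /entry_prod big_ord0.
have [I [lab [cI labn spanI]]] := IH (front p n).
set q := n ord_max.
pose lab' (x : I * ('I_q * 'I_q)) (m : nat) : nat * nat :=
  if (m < p)%N then lab x.1 m else (val x.2.1, val x.2.2).
have lab_front x (m : 'I_p) : lab' x m = lab x.1 m by rewrite /lab' ltn_ord.
have lab_last x : lab' x p = (val x.2.1, val x.2.2) by rewrite /lab' ltnn.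
exists (I * ('I_q * 'I_q))%type, lab'; split.
- by rewrite !card_prod !card_ord cI tdim_front -/q expnMn mulnn.
- move=> x m; have [mp|pm] := ltnP m p.
    have -> : m = widen_ord (leqnSn p) (Ordinal mp) by exact: val_inj.
    by rewrite [val _]/= (lab_front x (Ordinal mp)); exact: labn.
  have -> : m = ord_max by apply: val_inj; apply/eqP; rewrite eqn_leq pm -ltnS ltn_ord.
  by rewrite lab_last /=.
move=> r s; rewrite tdim_front -/q => rN sN.
have q0 : (0 < q)%N by case: (q) rN => //; rewrite muln0.
have dl x : (x < tdim (front p n) * q)%N -> (x %/ q < tdim (front p n))%N.
  by rewrite ltn_divLR.
have [c cP] := spanI _ _ (dl _ rN) (dl _ sN).
have [d dP] := delta_in_pure_span R q (Ordinal (ltn_pmod r q0)) (Ordinal (ltn_pmod s q0)).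
exists (fun x => c x.1 * d x.2) => r' s' r'N s'N.
transitivity ((\sum_x c x * entry_prod R p (front p n)
      (fun m => labelled_state R (front p n m) (lab x m)) (r' %/ q) (s' %/ q)) *
    (\sum_y d y * pure_state R q y.1 y.2 (Ordinal (ltn_pmod r' q0)) (Ordinal (ltn_pmod s' q0)))).
  rewrite mulr_suml -(pair_bigA _ (fun x y => c x * d y * entry_prod R p.+1 n
    (fun m => labelled_state R (n m) (lab' (x, y) m)) r' s')) /=.
  apply: eq_bigr => x _; rewrite mulr_sumr; apply: eq_bigr => y _.
  rewrite entry_prodS lab_last labelled_stateE.
  rewrite -[(r' %% _)%N]/(val (Ordinal (ltn_pmod r' q0))) -[(s' %% _)%N]/(val (Ordinal (ltn_pmod s' q0))).
  rewrite mxentryE mulrACA; congr (_ * _ * _).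
  by apply: eq_bigr => m _; rewrite /front_mx lab_front.
rewrite cP ?dl //.
have /matrixP/(_ (Ordinal (ltn_pmod r' q0)) (Ordinal (ltn_pmod s' q0))) := dP.
rewrite summxE mxE => E; under eq_bigr => y _ do rewrite -[pure_state _ _ _ _]/(pure_state R q y.1 y.2).
rewrite (eq_bigr (fun y => (d y *: pure_state R q y.1 y.2) (Ordinal (ltn_pmod r' q0)) (Ordinal (ltn_pmod s' q0)))); last by move=> y _; rewrite [RHS]mxE.
rewrite -E -natrM mulnb -!val_eqE /=; congr ((_ : bool)%:R).
have eqdm x y : (x == y) = ((x %/ q == y %/ q) && (x %% q == y %% q))%N.
  apply/eqP/andP => [->//|[/eqP xy /eqP xy']].
  by rewrite (divn_eq x q) (divn_eq y q) xy xy'.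
by rewrite (eqdm r' r) (eqdm s' s); do !case: (_ == _).
Qed.

(** Appending a factor to a dependent family. The factors are specified by their entries at natural
    number indices, and compared for equal values of [m], which avoids casts between matrix
    types. *)
Lemma extend_density (R : realType) (p : nat) (n : 'I_p.+1 -> nat)
    (A : forall m, 'M[R[i]]_(front p n m)) (B : 'M[R[i]]_(n ord_max)) :
  (forall m, density_matrix (A m)) -> density_matrix B ->
  exists2 A' : forall m, 'M[R[i]]_(n m), forall m, density_matrix (A' m) &
    forall r s, entry_prod R p.+1 n A' r s =
      entry_prod R p (front p n) A (r %/ n ord_max) (s %/ n ord_max)
      * mxentry B (r %% n ord_max) (s %% n ord_max).
Proof.
move=> Ad Bd.
have /fin_all_exists[A' A'P] : forall m : 'I_p.+1, exists X : 'M[R[i]]_(n m),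
    [/\ density_matrix X,
        forall m' : 'I_p, val m' = val m -> forall i j, mxentry X i j = mxentry (A m') i j
      & val m = p -> forall i j, mxentry X i j = mxentry B i j].
  move=> m; have [mp|pm] := ltnP m p.
    have -> : m = widen_ord (leqnSn p) (Ordinal mp) by exact: val_inj.
    exists (A (Ordinal mp)); split; first exact: Ad.
      by move=> m' mE; have -> : m' = Ordinal mp by exact: val_inj.
    by move=> /= mE; exfalso; move: mp; rewrite mE ltnn.
  have -> : m = ord_max by apply: val_inj; apply/eqP; rewrite eqn_leq pm -ltnS ltn_ord.
  exists B; split; [exact: Bd| |by []].
  by move=> m' mE; have := ltn_ord m'; rewrite [X in (X < _)%N]mE ltnn.
exists A' => [m|r s]; first by case: (A'P m).
rewrite entry_prodS; have [_ _ ->//] := A'P ord_max; congr (_ * _).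
by apply: eq_bigr => m _; have [_ /(_ m)-> // _] := A'P (widen_ord (leqnSn p) m).
Qed.

(** * Hermitian perturbations of scalar matrices *)

Lemma quad_formE (R : realType) (q : nat) (A : 'M[R[i]]_q) (v : 'cV[R[i]]_q) :
  (mxadj v *m A *m v) 0 0 = \sum_i \sum_j Num.conj (v i 0) * A i j * v j 0.
Proof.
rewrite mxE exchange_big; apply: eq_bigr => j _; rewrite mxE mulr_suml.
by apply: eq_bigr => i _; rewrite !mxE.
Qed.

(** By the inequality |v_i||v_j| <= (|v_i|^2 + |v_j|^2)/2, the form of [H] at [v] has modulus at
    most q e times the squared norm of [v], hence is dominated by the scalar part. *)
Lemma hpsd_perturb (R : realType) (q : nat) (a e : R) (H : 'M[R[i]]_q) :
  q%:R * e <= a -> Defs.hermitian H -> (forall i j, `|H i j| <= Complex e 0) ->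
  hpsd ((Complex a 0)%:M + H).
Proof.
move=> qe HH He; have /hermitian_conj Hc := HH.
split.
  apply/hermitian_conj => i j; rewrite !mxE rmorphD /= Hc eq_sym; congr (_ + _).
  by case: eqP => _; rewrite ?mulr0n ?rmorph0 // !mulr1n conjE /= oppr0.
move=> v; pose S := \sum_i `|v i 0| ^+ 2; pose z := (mxadj v *m H *m v) 0 0.
have S0 : 0 <= S by apply: sumr_ge0 => i _; rewrite exprn_ge0.
have -> : (mxadj v *m ((Complex a 0)%:M + H) *m v) 0 0 = Complex a 0 * S + z.
  rewrite mulmxDr mulmxDl mxE -/z; congr (_ + _).
  rewrite mul_mx_scalar -scalemxAl mxE; congr (_ * _).
  by rewrite mxE; apply: eq_bigr => i _; rewrite !mxE mulrC normCK.
have zr : z \is Num.real.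
  apply/CrealP; rewrite /z quad_formE rmorph_sum.
  under eq_bigr do rewrite rmorph_sum.
  rewrite exchange_big; apply: eq_bigr => i _; apply: eq_bigr => j _.
  by rewrite !rmorphM /= conjCK Hc; ring.
have zle : `|z| <= Complex (q%:R * e) 0 * S.
  rewrite /z quad_formE; apply: le_trans (ler_norm_sum _ _ _) _.
  apply: (@le_trans _ _ (\sum_(i < q) \sum_(j < q) Complex e 0 * (2^-1 * (`|v i 0| ^+ 2 + `|v j 0| ^+ 2)))).
    apply: ler_sum => i _; apply: le_trans (ler_norm_sum _ _ _) _.
    apply: ler_sum => j _; rewrite !normrM norm_conjC.
    have e0 : 0 <= Complex e 0 by apply: le_trans (He i j).
    rewrite [X in X <= _](_ : _ = `|H i j| * (`|v i 0| * `|v j 0|)); last by ring.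
    apply: ler_pM => //.
    set x := `|v i 0|; set y := `|v j 0|.
    have xy : 0 <= (x - y) ^+ 2 by rewrite real_exprn_even_ge0 // realB // normr_real.
    rewrite -subr_ge0 (_ : _ - _ = 2^-1 * (x - y) ^+ 2); last by field.
    by rewrite mulr_ge0 ?invr_ge0.
  have -> : Complex (q%:R * e) 0 = q%:R * Complex e 0 :> R[i].
    by rewrite ComplexM; congr (_ * _); exact: (rmorph_nat (real_complex R)).
  rewrite le_eqVlt; apply/orP; left; apply/eqP.
  transitivity (Complex e 0 * 2^-1 * \sum_(i < q) \sum_(j < q) (`|v i 0| ^+ 2 + `|v j 0| ^+ 2)).
    by rewrite mulr_sumr; apply: eq_bigr => i _; rewrite mulr_sumr; apply: eq_bigr => j _; rewrite mulrA.
  under eq_bigr do rewrite big_split /= sumr_const card_ord -/S -[_ *+ q]mulr_natl.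
  rewrite big_split /= sumr_const card_ord -mulr_sumr -/S -[_ *+ q]mulr_natl.
  by field.
have aq : Complex (q%:R * e) 0 * S <= Complex a 0 * S.
  by apply: ler_wpM2r => //; rewrite lecE /= eqxx.
have := real_lerNnormlW zr (lexx `|z|).
by move=> zN; rewrite -[z]opprK subr_ge0; apply: le_trans aq; apply: le_trans zle; rewrite lerNl.
Qed.

Lemma herm_of_le (R : realType) (N : nat) (Y : 'M[R]_N) (d : R) i j :
  (forall i j, `|Y i j| <= d) -> `|herm_of Y i j| <= Complex (d + d) 0.
Proof.
move=> Yd; have d0 : 0 <= d by apply: le_trans (Yd i j).
rewrite mxE; case: ifP => _; [|case: ifP => _]; apply: norm_le_ReIm => /=; rewrite ?normrN ?normr0 //; exact: Yd.
Qed.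

Lemma convex_comb_fin (R : realType) (N : nat) (P : 'M[R[i]]_N -> Prop) (I : finType)
    (w : I -> R) (X : I -> 'M[R[i]]_N) :
  (forall x, 0 <= w x) -> \sum_x w x = 1 -> (forall x, P (X x)) ->
  convex_comb_of P #|I| (\sum_x Complex (w x) 0 *: X x).
Proof.
move=> w0 w1 PX; exists (fun i => w (enum_val i)), (fun i => X (enum_val i)).
split => //.
  rewrite -w1 [RHS](reindex (@enum_val I I)) //; exact/onW_bij/enum_val_bij.
rewrite (reindex (@enum_val I I)) //; exact/onW_bij/enum_val_bij.
Qed.

Lemma trace_kron (R : realType) (M q : nat) (T : nat -> nat -> R[i]) (B : 'M[R[i]]_q) :
  \sum_(0 <= r < M * q) T (r %/ q)%N (r %/ q)%N * mxentry B (r %% q) (r %% q)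
  = (\sum_(0 <= i < M) T i i) * \tr B.
Proof.
rewrite (@sum_mul_divmod _ _ _ (fun i j => T i i * mxentry B j j)) mulr_suml.
by apply: eq_bigr => i _; rewrite -mulr_sumr mxentry_trace.
Qed.

Lemma hpsd_normalize (R : realType) (q : nat) (B : 'M[R[i]]_q) (w : R) :
  0 < w -> \tr B = Complex w 0 -> hpsd B -> density_matrix (Complex w^-1 0 *: B).
Proof.
move=> w0 trB [/hermitian_conj BH Bp]; split; first split.
- by apply/hermitian_conj => i j; rewrite !mxE rmorphM /= BH conjE /= oppr0.
- move=> v; rewrite -scalemxAr -scalemxAl mxE mulr_ge0 //.
  by rewrite lecE /= eqxx invr_ge0 ltW.
by rewrite mxtraceZ trB -ComplexM mulVf // lt0r_neq0.
Qed.

Lemma Sigma_k_ball (R : realType) (p : nat) (n : 'I_p.+1 -> nat) (k : nat) :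
  (forall m, (0 < n m)%N) -> (tdim (front p n) ^ 2 <= k)%N ->
  exists (X0 : 'M[R]_(tdim n)) (d : R), [/\ 0 < d, \tr X0 = 1 &
    forall X : 'M[R]_(tdim n), \tr X = 1 -> (forall i j, `|X i j - X0 i j| <= d) ->
      hcoords (@Sigma_k R p.+1 n k) X].
Proof.
move=> npos Mk.
have [I [lab [cI labn span]]] := labelled_products_span R p (front p n).
set M := tdim (front p n) in Mk cI labn span; set q := n ord_max.
pose L x m := labelled_state R (front p n m) (lab x m).
pose T x r s := entry_prod R p (front p n) (L x) r s.
have Ld x m : density_matrix (L x m).
  by have [? ?] := labn x m; exact: labelled_state_density.
have TH x r s : Num.conj (T x r s) = T x s r.
  by apply: entry_prod_conj => m; case: (Ld x m) => -[].
have Ttr x : \sum_(0 <= i < M) T x i i = 1.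
  rewrite entry_prod_trace big1 // => m _; rewrite mxentry_trace.
  by case: (Ld x m).
have q0 : (0 < q)%N by exact: npos.
have M0 : (0 < M)%N by apply: prodn_gt0 => m; exact: npos.
have NE : tdim n = (M * q)%N by rewrite tdim_front.
have dl (r : 'I_(tdim n)) : (r %/ q < M)%N by rewrite ltn_divLR // -NE.
have /fin_all_exists[c cP] : forall rs : 'I_M * 'I_M, exists c : I -> R[i],
    forall r' s', (r' < M)%N -> (s' < M)%N ->
      \sum_x c x * T x r' s' = ((r' == rs.1) && (s' == rs.2))%:R.
  by move=> [r s]; exact: span.
(* Each matrix unit of the M side is written in the product states, and this is substituted into the
   block decomposition of [D]; [C D x] collects the blocks multiplying the state [x]. *)
pose C (D : 'M[R[i]]_(tdim n)) x : 'M[R[i]]_q := \matrix_(i, j)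
  \sum_rs c rs x * mxentry D (val rs.1 * q + i) (val rs.2 * q + j).
have CE (D : 'M[R[i]]_(tdim n)) (r s : 'I_(tdim n)) :
    \sum_x T x (r %/ q)%N (s %/ q)%N * mxentry (C D x) (r %% q) (s %% q) = D r s.
  rewrite (eq_bigr (fun x => \sum_rs (c rs x * T x (r %/ q)%N (s %/ q)%N) *
      mxentry D (val rs.1 * q + r %% q) (val rs.2 * q + s %% q))); last first.
    move=> x _; rewrite -[(r %% q)%N]/(val (Ordinal (ltn_pmod r q0))).
    rewrite -[(s %% q)%N]/(val (Ordinal (ltn_pmod s q0))) mxentryE mxE mulr_sumr.
    by apply: eq_bigr => rs _ /=; ring.
  rewrite exchange_big (bigD1 (Ordinal (dl r), Ordinal (dl s))) //= -mulr_suml cP //=.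
  rewrite !eqxx mul1r -!divn_eq mxentryE big1 ?addr0 // => -[r1 s1] ne.
  rewrite -mulr_suml cP //= (_ : (_ && _) = false) ?mul0r //.
  apply/negbTE; apply: contra ne => /andP[/eqP rE /eqP sE].
  by rewrite xpair_eqE -!val_eqE /= rE sE !eqxx.
(* The coefficients are complex, so [C D x] may fail to be Hermitian. As the product states are
   Hermitian, averaging the expansion with its adjoint still gives [D] when [D] is Hermitian. *)
pose H D x : 'M[R[i]]_q := 2^-1 *: (C D x + mxadj (C D x)).
have HH D x : Defs.hermitian (H D x).
  apply/hermitian_conj => i j; rewrite !mxE rmorphM rmorphD /= conjCK addrC.
  by congr (_ * _); rewrite geC0_conj // invr_ge0.
have HE D (r s : 'I_(tdim n)) : Defs.hermitian D ->
    \sum_x T x (r %/ q)%N (s %/ q)%N * mxentry (H D x) (r %% q) (s %% q) = D r s.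
  move=> /hermitian_conj DH.
  have -> : D r s = 2^-1 * (D r s + Num.conj (D s r)) by rewrite DH; field.
  rewrite -(CE D r s) -(CE D s r) rmorph_sum -big_split mulr_sumr; apply: eq_bigr => x _ /=.
  rewrite -[(r %% q)%N]/(val (Ordinal (ltn_pmod r q0))).
  rewrite -[(s %% q)%N]/(val (Ordinal (ltn_pmod s q0))) !mxentryE !mxE rmorphM /= TH.
  by ring.
(* A bound, uniform in [x], for the linear map from [D] to [C D x] in the largest modulus of an
   entry. *)
pose Kc := \sum_x \sum_rs (`|complex.Re (c rs x)| + `|complex.Im (c rs x)|).
have Kc0 : 0 <= Kc by do 2 (apply: sumr_ge0 => ? _); rewrite addr_ge0.
have CK (D : 'M[R[i]]_(tdim n)) (e : R) x i j : 0 <= e -> (forall r s, `|D r s| <= Complex e 0) ->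
    `|C D x i j| <= Complex (Kc * e) 0.
  move=> e0 De; rewrite mxE; apply: le_trans (ler_norm_sum _ _ _) _.
  apply: (@le_trans _ _ (\sum_rs
      Complex (`|complex.Re (c rs x)| + `|complex.Im (c rs x)|) 0 * Complex e 0)).
    apply: ler_sum => rs _; rewrite normrM ler_pM //; first exact: norm_le_ReIm.
    rewrite /mxentry; case: insubP => [? _ _|_]; [case: insubP => [? _ _|_] //|];
      by rewrite normr0 lecE /= eqxx.
  rewrite -mulr_suml -Complex_sum -ComplexM lecE /= eqxx /= ler_wpM2r //.
  rewrite /Kc (bigD1 x) //= lerDl; do 2 (apply: sumr_ge0 => ? _); exact: addr_ge0.
have HK (D : 'M[R[i]]_(tdim n)) (e : R) x i j : 0 <= e -> (forall r s, `|D r s| <= Complex e 0) ->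
    `|H D x i j| <= Complex (Kc * e) 0.
  move=> e0 De.
  have -> : H D x i j = 2^-1 * (C D x i j + Num.conj (C D x j i)) by rewrite !mxE.
  rewrite normrM.
  apply: (@le_trans _ _ (2^-1 * (Complex (Kc * e) 0 + Complex (Kc * e) 0))).
    rewrite ger0_norm ?invr_ge0 // ler_wpM2l ?invr_ge0 //.
    by apply: le_trans (ler_normD _ _) _; rewrite norm_conjC lerD ?CK.
  by rewrite le_eqVlt; apply/orP; left; apply/eqP; field.
(* Each of the M^2 terms of the centre has trace q a, so this value gives total trace 1. *)
pose a : R := (q%:R * (M ^ 2)%:R)^-1.
have qR : 1 <= q%:R :> R by rewrite ler1n.
have a0 : 0 < a by rewrite invr_gt0 mulr_gt0 // ltr0n // expn_gt0 M0.
(* With this margin q eta = a/2, which keeps every perturbed factor positive with positive trace. *)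
pose eta := a / (2 * q%:R).
have q2 : 0 < 2 * q%:R :> R by lra.
have eta0 : 0 < eta by rewrite divr_gt0.
have qeta : q%:R * eta = a / 2 by rewrite /eta; move: (q%:R : R) qR => z z1; field; apply: lt0r_neq0; lra.
have etaa : eta < a.
  have : eta <= q%:R * eta by rewrite ler_peMl // ltW.
  by rewrite qeta; lra.
(* A change of the real coordinates by d moves complex entries by at most 2d, hence the factors by
   at most eta; adding 1 to [Kc] avoids a zero denominator. *)
pose d := eta / (2 * (Kc + 1)).
have d0 : 0 < d by rewrite divr_gt0 //; lra.
have Kd : Kc * (d + d) <= eta.
  have -> : Kc * (d + d) = eta * (Kc / (Kc + 1)) by rewrite /d; field; apply: lt0r_neq0; lra.
  by rewrite ler_piMr ?(ltW eta0) // ler_pdivrMr; lra.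
pose A0 : 'M[R[i]]_(tdim n) := \matrix_(r, s)
  \sum_x T x (r %/ q)%N (s %/ q)%N * mxentry ((Complex a 0)%:M : 'M[R[i]]_q) (r %% q) (s %% q).
have aH : Defs.hermitian ((Complex a 0)%:M : 'M[R[i]]_q).
  apply/hermitian_conj => i j; rewrite !mxE eq_sym.
  by case: eqP => _; rewrite ?mulr0n ?rmorph0 // !mulr1n conjE /= oppr0.
have A0H : Defs.hermitian A0.
  apply/hermitian_conj => r s; rewrite !mxE rmorph_sum; apply: eq_bigr => x _.
  by rewrite rmorphM /= TH mxentry_conj.
have trE (B : I -> 'M[R[i]]_q) (A : 'M[R[i]]_(tdim n)) :
    (forall r s, A r s = \sum_x T x (r %/ q)%N (s %/ q)%N * mxentry (B x) (r %% q) (s %% q)) ->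
    \tr A = \sum_x \tr (B x).
  move=> AE; rewrite /mxtrace; under eq_bigr do rewrite AE.
  rewrite exchange_big; apply: eq_bigr => x _.
  rewrite -(big_mkord xpredT (fun r => T x (r %/ q)%N (r %/ q)%N * mxentry (B x) (r %% q) (r %% q))).
  by rewrite NE trace_kron Ttr mul1r.
exists (hermitian_coords R _ A0), d; split => //.
  rewrite trace_hermitian_coords (trE (fun=> (Complex a 0)%:M)); last by move=> r s; rewrite mxE.
  rewrite sumr_const cI mxtrace_scalar -mulrnA -[_ *+ _]mulr_natl.
  rewrite -(rmorph_nat (real_complex R)) -[_ * _]ComplexM /= /a natrM mulfV //.
  by rewrite mulf_neq0 // lt0r_neq0 // ltr0n // expn_gt0 M0.
move=> X trX Xd; rewrite /hcoords /=.
pose D := herm_of (X - hermitian_coords R _ A0).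
have DH : Defs.hermitian D by exact: herm_of_hermitian.
have De r s : `|D r s| <= Complex (d + d) 0.
  by apply: herm_of_le => i j; rewrite !mxE; have := Xd i j; rewrite !mxE.
have XE : herm_of X = A0 + D.
  by rewrite -[X in X + _](hermitian_coordsK R _ _ A0H) /D -herm_ofD addrC subrK.
pose B x := (Complex a 0)%:M + H D x.
have dd0 : 0 <= d + d by lra.
have Heta x i j : `|H D x i j| <= Complex eta 0.
  by apply: le_trans (HK D _ x i j dd0 De) _; rewrite lecE /= eqxx.
have Bp x : hpsd (B x) by apply: (@hpsd_perturb R q a eta) => //; rewrite qeta; lra.
(* The traces of the perturbed factors become the weights; dividing by them turns the factors into
   density matrices. *)
pose w x := complex.Re (\tr (B x)).
have trB x : \tr (B x) = Complex (w x) 0.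
  rewrite /w [LHS]complexE; have -> : complex.Im (\tr (B x)) = 0; last first.
    by rewrite -[(0%:C)%C]/(0 : R[i]) mulr0 addr0.
  apply: ger0_Im; apply: sumr_ge0 => i _.
  have := @psd_quad2 R q (B x) i i 0 (Bp x).
  by rewrite rmorph0 !mul0r !addr0.
have w0 x : 0 < w x.
  rewrite /w -trace_hermitian_coords /mxtrace.
  apply: (@lt_le_trans _ _ (\sum_(i < q) (a - eta))).
    by rewrite sumr_const card_ord -[_ *+ _]mulr_natl mulr_gt0 //; lra.
  apply: ler_sum => i _; rewrite mxE eqxx mxE mxE eqxx mulr1n.
  have [] := ReIm_le_norm R _ _ (Heta x i i); rewrite ler_norml.
  by case: (H D x i i) => y z /=; lra.
have XB r s : herm_of X r s =
    \sum_x T x (r %/ q)%N (s %/ q)%N * mxentry (B x) (r %% q) (s %% q).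
  rewrite XE mxE -(HE D r s DH) mxE -big_split; apply: eq_bigr => x _ /=.
  rewrite -mulrDr -[(r %% q)%N]/(val (Ordinal (ltn_pmod r q0))).
  by rewrite -[(s %% q)%N]/(val (Ordinal (ltn_pmod s q0))) !mxentryE [B x _ _]mxE.
have w1 : \sum_x w x = 1.
  have := trE B _ XB; rewrite (eq_bigr _ (fun x _ => trB x)) -Complex_sum.
  rewrite -{1}(herm_ofK R _ X) in trX; rewrite trace_hermitian_coords in trX.
  by move=> E; move: trX; rewrite E.
have ext x := extend_density R p n (L x) (Complex (w x)^-1 0 *: B x) (Ld x)
  (hpsd_normalize R q (B x) (w x) (w0 x) (trB x) (Bp x)).
have /fin_all_exists[A AP] : forall x, exists A' : forall m, 'M[R[i]]_(n m),
    (forall m, density_matrix (A' m)) /\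
    forall r s, entry_prod R p.+1 n A' r s =
      T x (r %/ q)%N (s %/ q)%N * mxentry (Complex (w x)^-1 0 *: B x) (r %% q) (s %% q).
  by move=> x; have [A' A'd A'E] := ext x; exists A'.
exists #|I|; split; first by rewrite cI.
have -> : herm_of X = \sum_x Complex (w x) 0 *: prod_mx (A x).
  apply/matrixP => r s; rewrite XB summxE; apply: eq_bigr => x _.
  rewrite mxE prod_mxE (AP x).2.
  rewrite -[(r %% q)%N]/(val (Ordinal (ltn_pmod r q0))).
  rewrite -[(s %% q)%N]/(val (Ordinal (ltn_pmod s q0))) !mxentryE [in RHS]mxE.
  rewrite [RHS]mulrCA; congr (_ * _).
  by rewrite mulrA -ComplexM mulfV ?lt0r_neq0 // -[Complex 1 0]/(1 : R[i]) mul1r.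
apply: convex_comb_fin => [x||x] //; first exact: ltW.
by exists (A x); split => //; exact: (AP x).1.
Qed.

(** * Balls, open sets and measure in the hyperplane of trace one *)

Lemma open_entries_ball (R : realType) (N : nat) (X0 : 'M[R]_N) (d : R) :
  open [set X : 'M[R]_N | forall i j, `|X i j - X0 i j| < d].
Proof.
rewrite openE => X XX.
exists (fun i j => [set y | `|y - X0 i j| < d]); last by [].
move=> i j; have d0 : 0 < d by apply: le_lt_trans (XX i j).
apply: open_nbhs_nbhs; split; last exact: XX.
rewrite (_ : [set y | _] = ball (X0 i j) d); first exact: ball_open.
by apply/seteqP; split => y /=; rewrite /ball /= distrC.
Qed.

Lemma coordT_diag_sum (R : realType) (N : nat) (y : coordT N -> R) :
  \sum_(t : coordT N | (val t).1 == (val t).2) y t =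
  \sum_(i : 'I_N | (0 < i)%N) oapp y 0 (insub (i, i)).
Proof.
rewrite [RHS](reindex_omap (fun t : coordT N => (val t).1)
  (fun i : 'I_N => insub (i, i) : option (coordT N))) /=; last first.
  by move=> i i0; rewrite insubT /= ?eqxx ?i0.
apply: eq_big => [[[i j] /= ij]|[[i j] /= ij] /eqP /= E].
  apply/eqP/andP => [E|[_ /eqP]].
    have i0 : (0 < i)%N by case/orP: (ij) => //=; rewrite E eqxx.
    split => //; subst j.
    by rewrite insubT /= ?eqxx ?i0 // => H; apply/eqP; congr Some; apply: val_inj.
  by case: insubP => // t _ /= tE [] /(congr1 val) /=; rewrite tE => -[].
by subst j; rewrite insubT.
Qed.

Lemma tau_coordE (R : realType) (N : nat) (y : coordT N -> R) (t : coordT N) :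
  tau_coord y (val t).1 (val t).2 = y t.
Proof. by rewrite mxE -surjective_pairing valK. Qed.

Lemma trace_tau_coord (R : realType) (N : nat) (y : coordT N -> R) :
  (0 < N)%N -> \tr (tau_coord y) = 1.
Proof.
case: N y => // N y _; rewrite /mxtrace (bigD1 ord0) //= mxE insubF ?eqxx //.
rewrite coordT_diag_sum [X in _ + X](_ : _ = \sum_(i : 'I_N.+1 | (0 < i)%N) oapp y 0 (insub (i, i))).
  by rewrite subrK.
apply: eq_big => [i|i i0]; first by rewrite lt0n -val_eqE.
by rewrite mxE; case: insubP => //=; rewrite eqxx /= lt0n -val_eqE /= in i0 *; rewrite i0.
Qed.

(** In affine coordinates one diagonal entry is missing. Its deviation is minus the sum of the other
    diagonal deviations, so a cube of half-side d/N in the coordinates stays within d in every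
    entry. *)
Lemma tau_null_no_ball (R : realType) (N : nat) (S : set 'M[R[i]]_N) (X0 : 'M[R]_N) (d : R) :
  (0 < N)%N -> 0 < d -> \tr X0 = 1 ->
  (forall X, \tr X = 1 -> (forall i j, `|X i j - X0 i j| <= d) -> hcoords S X) ->
  ~ tau_null S.
Proof.
move=> N0 d0 trX0 XS.
have NR : 1 <= N%:R :> R by rewrite ler1n.
have dN0 : 0 < d / N%:R by rewrite divr_gt0 //; lra.
apply: (@null_set_no_box R _ _ (fun t : coordT N => X0 (val t).1 (val t).2) (d / N%:R)) => // y yX0.
apply: (XS (tau_coord y)); first exact: trace_tau_coord.
have offd (i j : 'I_N) : (i != j) || (0 < i)%N -> `|tau_coord y i j - X0 i j| <= d / N%:R.
  move=> ij; pose t : coordT N := Sub (i, j) ij.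
  by have := yX0 t; rewrite -(tau_coordE R N y t).
have dNd : d / N%:R <= d by rewrite ler_pdivrMr ?ler_peMr //; lra.
move=> i j; have [ij|] := boolP ((i != j) || (0 < i)%N).
  exact: le_trans (offd _ _ ij) _.
rewrite negb_or negbK -leqNgt leqn0 => /andP[/eqP <- /eqP i0].
have : \tr (tau_coord y) - \tr X0 = 0 by rewrite trace_tau_coord // trX0 subrr.
rewrite /mxtrace -sumrB (bigD1 i) //= => /eqP; rewrite addr_eq0 => /eqP ->.
rewrite normrN; apply: le_trans (ler_norm_sum _ _ _) _.
apply: (@le_trans _ _ (\sum_(k : 'I_N) d / N%:R)).
  rewrite big_mkcond; apply: ler_sum => k _; case: ifP => ki; last exact: ltW.
  by apply: offd; rewrite eqxx lt0n -i0 val_eqE.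
by rewrite sumr_const card_ord -[_ *+ _]mulr_natl mulrC divfK //; lra.
Qed.

Theorem theorem1 (R : realType) (p : nat) (n : 'I_p.+1 -> nat) (k : nat)
  (npos : forall m, (0 < n m)%N)
  (nmono : forall i j : 'I_p.+1, (i <= j)%N -> (n i <= n j)%N)
  (nlast : (\prod_(m < p.+1 | (m < p)%N) n m <= n ord_max)%N)
  (kpos : (0 < k)%N) :
  [/\ (* (a) *)
      [/\ (@Sigma_k R p.+1 n k) `<=` (@Sigma R p.+1 n),
          connected (hcoords ((@Sigma_k R p.+1 n k))),
          compact (hcoords ((@Sigma_k R p.+1 n k)))
        & (@Sigma_k R p.+1 n k) <> (@Sigma R p.+1 n) ->
          ~ (hcoords ((@Sigma R p.+1 n)) `<=` closure (hcoords ((@Sigma_k R p.+1 n k)))) /\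
          exists U : set 'M[R]_(tdim n), open U /\
            hcoords ((@Sigma R p.+1 n)) `\` hcoords ((@Sigma_k R p.+1 n k))
              = U `&` hcoords ((@Sigma R p.+1 n))],
      (* (b) *)
      (k < (\prod_(m < p.+1 | (m < p)%N) n m) ^ 2)%N ->
        tau_null ((@Sigma_k R p.+1 n k))
    & (* (c) *)
      ((\prod_(m < p.+1 | (m < p)%N) n m) ^ 2 <= k)%N ->
        ~ tau_null ((@Sigma_k R p.+1 n k)) /\
        exists U : set 'M[R]_(tdim n), [/\ open U,
          U `&` @tau1 R (tdim n) !=set0
        & U `&` @tau1 R (tdim n) `<=` hcoords ((@Sigma_k R p.+1 n k))]].
Proof.
have N0 : (0 < tdim n)%N by apply: prodn_gt0 => m; exact: npos.
have cl : closed (hcoords (@Sigma_k R p.+1 n k)).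
  by apply: compact_closed; [exact: norm_hausdorff|exact: hcoords_Sigma_k_compact].
have sub : @Sigma_k R p.+1 n k `<=` @Sigma R p.+1 n by move=> B [l [_ ?]]; exists l.
rewrite front_prodE in nlast *; split.
- split => //; [exact: hcoords_Sigma_k_connected|exact: hcoords_Sigma_k_compact|].
  move=> ne; split.
    move=> dense; apply: ne; apply/seteqP; split => // B SB.
    (* Density is a statement about real coordinates; a separable [B] is recovered from its
       coordinates because it is Hermitian. *)
    have BH : Defs.hermitian B.
      have [l [w [X [_ _ PX ->]]]] := SB.
      have [A /all_and2[Ad XE]] := fin_all_exists PX.
      rewrite (eq_bigr (fun i => Complex (w i) 0 *: prod_mx (A i))); last first.
        by move=> i _; rewrite XE.
      by apply: hermitian_sum_prod_mx => i m; case: (Ad i m) => -[].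
    move: dense; rewrite -((closure_id _).1 cl) => dense.
    rewrite -(hermitian_coordsK R _ _ BH); apply: dense.
    by rewrite /hcoords /= hermitian_coordsK.
  exists (~` hcoords (@Sigma_k R p.+1 n k)); split; first exact: closed_openC.
  by rewrite setDE setIC.
- move=> kM; exact: Sigma_k_null.
move=> Mk; have [X0 [d [d0 trX0 XS]]] := Sigma_k_ball R p n k npos Mk.
split; first exact: tau_null_no_ball XS.
exists [set X | forall i j, `|X i j - X0 i j| < d]; split.
- exact: open_entries_ball.
- by exists X0; split => // i j; rewrite subrr normr0.
- by move=> X [Xd trX]; apply: XS => // i j; exact: ltW.
Qed.
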